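(* Let $G$ be a finite bipartite graph with parts $X$ and $Y$, and define $$r=\max_{v\in X}\deg(v).$$ There exists a constant $c>0$, depending only on $G$ and $r$, such that for every power $q$ of an odd prime, every integer $d\ge1$ and every $E\subset\mathbb{F}_q^d$, if $$|E|\ge c\cdot q^{\max\left(\frac{d+1}{2},r\right)},$$ then $\Delta_G(E)\supset\mathbb{F}_q\setminus\{0\}$.
   Context: Graphs are simple and undirected; subgraphs need not be induced. Saying that $X$ and $Y$ are parts of a bipartite graph means that they are independent sets of vertices which form a partition of the vertex set (they are not determined uniquely by the graph). $\mathbb{F}_q$ is the field with $q$ elements, $q$ a power of an odd prime. For $x\in\mathbb{F}_q^d$ put $\|x\|=x_1^2+\cdots+x_d^2\in\mathbb{F}_q$. For $E\subset\mathbb{F}_q^d$ and $t\in\mathbb{F}_q$, the $t$-distance graph $\mathcal{G}_t(E)$ has vertex set $E$, with $x\sim y$ if and only if $\|x-y\|=t$. The $G$-distance set is $\Delta_G(E)=\{t\in\mathbb{F}_q:\mathcal{G}_t(E)\text{ contains a subgraph isomorphic to }G\}$. *)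

(* Defs.v *)
From mathcomp Require Import all_boot all_order all_algebra.
From mathcomp Require Import all_classical all_reals all_analysis.

Set Implicit Arguments.
Unset Strict Implicit.
Unset Printing Implicit Defensive.

Import Order.TTheory GRing.Theory Num.Theory.

Local Open Scope ring_scope.

(* The vertex set is a subset of the ambient finType, so that a graph and its
   subgraphs live in the same type. *)
Record sgraph (T : finType) := SGraph {
  vset : {set T};
  adj : rel T;
  adj_vset : forall x y, adj x y -> x \in vset;
  adj_sym : symmetric adj;
  adj_irrefl : irreflexive adj
}.

Definition deg (T : finType) (G : sgraph T) (v : T) : nat := #|adj G v|.

Definition independent (T : finType) (G : sgraph T) (A : {set T}) : Prop :=
  {in A &, forall x y, ~~ adj G x y}.

(* One of the two parts may be empty. *)
Definition bipartite_parts (T : finType) (G : sgraph T) (X Y : {set T}) : Prop :=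
  [/\ X :|: Y = vset G, [disjoint X & Y], independent G X & independent G Y].

(* Not necessarily induced. *)
Definition subgraph (T : finType) (H G : sgraph T) : Prop :=
  vset H \subset vset G /\ subrel (adj H) (adj G).

(* Only the restriction of [f] to the vertex set matters. *)
Definition isomorphic (T U : finType) (G : sgraph T) (H : sgraph U) : Prop :=
  exists f : T -> U,
    [/\ {in vset G &, injective f}, f @: vset G = vset H &
        {in vset G &, forall x y, adj H (f x) (f y) = adj G x y}].

Definition qnorm (F : finFieldType) (d : nat) (x : 'rV[F]_d) : F :=
  \sum_(i < d) x 0 i ^+ 2.

(* The condition [x != y] excludes loops; it is redundant unless [t = 0]. *)
Definition dist_adj (F : finFieldType) (d : nat) (t : F) (E : {set 'rV[F]_d})
  (x y : 'rV[F]_d) : bool :=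
  [&& x \in E, y \in E, x != y & qnorm (x - y) == t].

Lemma dist_adj_vset (F : finFieldType) (d : nat) (t : F) (E : {set 'rV[F]_d})
  (x y : 'rV[F]_d) : dist_adj t E x y -> x \in E.
Proof. by case/and4P. Qed.

Lemma dist_adj_sym (F : finFieldType) (d : nat) (t : F) (E : {set 'rV[F]_d}) :
  symmetric (dist_adj t E).
Proof.
move=> x y; rewrite /dist_adj andbCA eq_sym.
have -> // : qnorm (x - y) = qnorm (y - x).
by apply: eq_bigr => i _; rewrite -opprB mxE sqrrN.
Qed.

Lemma dist_adj_irrefl (F : finFieldType) (d : nat) (t : F)
  (E : {set 'rV[F]_d}) : irreflexive (dist_adj t E).
Proof. by move=> x; rewrite /dist_adj eqxx !andbF. Qed.

Definition dist_graph (F : finFieldType) (d : nat) (t : F)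
  (E : {set 'rV[F]_d}) : sgraph 'rV[F]_d :=
  SGraph (@dist_adj_vset F d t E) (dist_adj_sym t E) (dist_adj_irrefl t E).

Definition graph_dist_set (T : finType) (G : sgraph T) (F : finFieldType)
  (d : nat) (E : {set 'rV[F]_d}) : set F :=
  [set t | exists H : sgraph 'rV[F]_d,
             subgraph H (dist_graph t E) /\ isomorphic G H]%classic.

(* Main.v *)
Require Import Defs.
From mathcomp Require Import all_classical all_reals all_analysis.
From mathcomp Require Import all_boot all_order all_algebra.
From mathcomp Require Import all_fingroup all_solvable all_field all_character.
From mathcomp Require Import zify ring.
Set Implicit Arguments.
Unset Strict Implicit.
Unset Printing Implicit Defensive.

Import Order.TTheory GRing.Theory Num.Theory.

Local Open Scope ring_scope.

(* The number nu of ordered pairs of E at distance t satisfies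
   |q nu - |E|^2| <= 2 q^((d+1)/2) |E| (Iosevich--Rudnev), so the t-distance graph
   on E has nu >= |E|^2 / (2q), and dependent random choice embeds any bipartite
   graph whose degrees on one side are at most r once |E| >= C q^r.

   By Fourier analysis the error term reduces to a Salie sum for d odd, which is
   evaluated by completing the square, and to a Kloosterman sum K for d even, where
   Weil's bound |K| <= 2 sqrt q is needed.  Weil's bound is proved as follows.  The
   Kloosterman sum over the quadratic extension is 2q - K^2, so that a violation of
   the bound gets amplified along a tower of quadratic extensions L of F.  Over L,
   averaging over the shifts v -> v + y^q - y gives |K_L| <= C(q) sqrt |L| from the
   bound C(q) sqrt |L| for sums of the quadratic character over the values of
   a squarefree polynomial of degree 2q; the latter is Stepanov's method. *)

(** * Stepanov's method *)

(** The coefficients form a matrix with more rows than columns, and a nonzero vector of its left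
    kernel is [c]. *)
Lemma lin_dep_polys (F : fieldType) (T : finType) (N : nat) (g : T -> {poly F}) :
  (forall t, (size (g t) <= N)%N) -> (N < #|T|)%N ->
  exists2 c : T -> F, (exists t, c t != 0) & \sum_t c t *: g t = 0.
Proof.
move=> sz ltN; pose M := \matrix_(i < #|T|, j < N) (g (enum_val i))`_j.
have : kermx M != 0.
  rewrite -mxrank_eq0 mxrank_ker -lt0n subn_gt0.
  exact: leq_ltn_trans (rank_leq_col M) ltN.
case/rowV0Pn => v /sub_kermxP vM vn0.
exists (fun t => v 0 (enum_rank t)).
  case/rV0Pn: vn0 => i vi; exists (enum_val i); by rewrite enum_valK.
apply/polyP => j; rewrite coef_sum coef0.
have [ltj|lej] := ltnP j N; last first.
  by rewrite big1 // => t _; rewrite coefZ nth_default ?mulr0 // (leq_trans (sz t)).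
have /eqP := congr1 (fun A : 'rV_N => A 0 (Ordinal ltj)) vM; rewrite !mxE => /eqP vM0.
rewrite -[RHS]vM0 (reindex (@enum_val T T)) /=; last first.
  by exists enum_rank => x _; rewrite ?enum_valK ?enum_rankK.
by apply: eq_bigr => i _; rewrite coefZ !mxE enum_valK.
Qed.

(** As the coefficients have degree below [s], the terms [A_k X^(s k)] occupy disjoint ranges of
    exponents and cannot cancel. *)
Lemma horner_Xn_eq0 (F : fieldType) (s : nat) (A : {poly {poly F}}) :
  (forall k, (size (A`_k)%R <= s)%N) -> A.['X^s] = 0 -> A = 0.
Proof.
elim/poly_ind: A => [//|A c IH] sz.
have sc : (size c <= s)%N.
  by have := sz 0%N; rewrite coefD coefMX coefC eqxx add0r.
rewrite hornerMXaddC => e0.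
have c0 : c = 0.
  apply/eqP; case: (eqVneq c 0) => // cn0.
  have : 'X^s %| c by rewrite -(addr0_eq e0) dvdpNr dvdp_mull.
  by move/(dvdp_leq cn0); rewrite size_polyXn ltnNge sc.
move: e0; rewrite c0 addr0 => /eqP; rewrite mulf_eq0.
rewrite expf_eq0 polyX_eq0 andbF orbF => /eqP A0.
rewrite IH ?mul0r ?addr0 // => k.
by have := sz k.+1; rewrite coefD coefMX coefC /= addr0.
Qed.

Lemma expr_sum_pchar (R : comNzRingType) (s : nat) (I : finType) (g : I -> R) :
  [pchar R].-nat s -> (\sum_i g i) ^+ s = \sum_i g i ^+ s.
Proof.
move=> hs; apply: (big_morph (fun x => x ^+ s)) => [x y|].
  exact: exprDn_pchar hs.
by rewrite expr0n; case: s hs.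
Qed.

Lemma size_coef_mul (F : fieldType) (m n : nat) (A B : {poly {poly F}}) :
  (forall k, (size (A`_k)%R <= m)%N) -> (forall k, (size (B`_k)%R <= n)%N) ->
  forall k, (size ((A * B)`_k)%R <= (m + n).-1)%N.
Proof.
move=> hA hB k; rewrite coefM; apply: (leq_trans (size_sum _ _ _)).
apply/bigmax_leqP => i _; apply: (leq_trans (size_polyMleq _ _)).
by rewrite -!subn1 leq_sub2r // leq_add.
Qed.

(** A square root of [f] divides both [f] and its derivative, hence is constant. *)
Lemma separable_not_square (F : fieldType) (f t : {poly F}) :
  coprimep f f^`() -> (1 < size f)%N -> t ^+ 2 != f.
Proof.
move=> cop szf; apply/eqP => tf.
have tdf : t %| f by rewrite -tf expr2 dvdp_mulr.
have tdf' : t %| f^`().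
  by rewrite -tf expr2 derivM; apply: dvdp_add; [apply: dvdp_mull | apply: dvdp_mulr].
have tg : t %| gcdp f f^`() by rewrite dvdp_gcd tdf.
have gn0 : gcdp f f^`() != 0 by rewrite -size_poly_eq0 (eqP cop).
have szt := dvdp_leq gn0 tg; rewrite (eqP cop) in szt.
have := size_polyMleq t t; rewrite -expr2 tf -subn1; move: szt szf.
by move: (size t) (size f) => m n; clear; lia.
Qed.

(* The square of [h = P(X^s) + f^(a+1) R(X^s)] being zero would give
   [P(Y)^2 = f(X) f_s(Y) R(Y)^2], whose leading coefficients in [Y] make [f] a
   square. *)
Lemma stepanov_aux_neq0 (F : fieldType) (s a e : nat) (f : {poly F})
    (A B : {poly {poly F}}) :
  [pchar F].-nat s -> s = a.*2.+1 -> (0 < e <= a)%N ->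
  f \is monic -> size f = e.*2.+1 -> coprimep f f^`() ->
  (forall k, (size (A`_k)%R <= a.+1)%N) -> (forall k, (size (B`_k)%R <= a - e)%N) ->
  A.['X^s] + f ^+ a.+1 * B.['X^s] = 0 -> A = 0 /\ B = 0.
Proof.
move=> hs sE /andP[e0 ea] mf szf cop szA szB h0.
(* By Frobenius, [f^s = fs(X^s)]. *)
pose fs := map_poly (fun x => x ^+ s) f.
have z0 : 0 ^+ s = 0 :> F by rewrite sE expr0n.
have fsE : f ^+ s = fs \Po 'X^s.
  have hsp : [pchar {poly F}].-nat s by rewrite (eq_pnat _ (@pchar_poly F)).
  rewrite -[f in LHS]coefK poly_def expr_sum_pchar // comp_polyE.
  have -> : size fs = size f.
    by rewrite size_poly_eq // expf_neq0 // lead_coef_eq0 monic_neq0.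
  apply: eq_bigr => i _; rewrite exprZn coef_map_id0 //.
  by rewrite -exprM mulnC exprM.
have mfs : lead_coef fs = 1.
  by rewrite lead_coef_map_id0 ?(monicP mf) ?expr1n ?oner_eq0.
(* Squaring [A(X^s) = - f^(a+1) B(X^s)] produces [f^(2a+2) = f f^s], because [s = 2a+1]. The
   coefficients of [C] have degree below [s] in [X], so the relation lifts from [Y = X^s] to a free
   variable [Y]. *)
pose C := A ^+ 2 - f%:P * fs^:P * B ^+ 2.
have C0 : C = 0.
  apply: (@horner_Xn_eq0 _ s).
    move=> k; rewrite coefB; apply: (leq_trans (size_polyD _ _)).
    rewrite geq_max size_polyN expr2 (leq_trans (size_coef_mul szA szA k)) ?sE; last by lia.
    have sz1 j : (size ((f%:P * fs^:P)`_j)%R <= (e.*2.+1 + 1).-1)%N.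
      apply: size_coef_mul => i; first by rewrite coefC; case: eqP; rewrite ?szf ?size_poly0.
      by rewrite coef_map size_polyC leq_b1.
    have sz2 := size_coef_mul szB szB.
    rewrite expr2; apply: (leq_trans (size_coef_mul sz1 sz2 k)).
    by clear -ea; lia.
  rewrite /C !expr2 hornerD hornerN !hornerM hornerC -/(comp_poly _ _) -fsE -!expr2.
  have -> : A.['X^s] = - (f ^+ a.+1 * B.['X^s]) by apply/eqP; rewrite -addr_eq0 h0.
  apply/eqP; rewrite subr_eq0 sqrrN exprMn -exprS -exprM sE.
  by apply/eqP; congr (f ^+ _ * _); lia.
have AB : A ^+ 2 = f%:P * fs^:P * B ^+ 2 by apply/eqP; rewrite -subr_eq0 -/C C0.
have fn0 := monic_neq0 mf.
have fsn0 : fs != 0 by rewrite -lead_coef_eq0 mfs oner_eq0.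
have [B0|Bn0] := eqVneq B 0.
  by split=> //; apply/eqP; move/eqP: AB; rewrite B0 expr0n mulr0 expf_eq0.
exfalso.
have := congr1 lead_coef AB; rewrite !expr2 !lead_coefM lead_coefC -!expr2.
rewrite lead_coef_map_inj ?polyC0 //; do ?[exact: polyC_inj].
rewrite mfs mulr1; set p := lead_coef A; set r := lead_coef B => pr.
have rn0 : r != 0 by rewrite lead_coef_eq0.
have : r %| p by rewrite -(@dvdp_pexp2r _ _ _ 2) // pr dvdp_mull.
case/dvdpP => t pt; move/eqP: (pr); rewrite pt exprMn (inj_eq (mulIf _)) ?expf_neq0 //.
apply/negP; apply: separable_not_square => //.
by rewrite szf; lia.

Qed.

Lemma poly_vanish_card (F : finFieldType) (h : {poly F}) (A : {set F}) :
  h != 0 -> {in A, forall y, h.[y] = 0} -> (#|A| < size h)%N.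
Proof.
move=> hn0 hA; rewrite cardE; apply: max_poly_roots => //; last exact: enum_uniq.
by apply/allP => y; rewrite mem_enum => /hA /rootP.
Qed.

Lemma size_bigsum_poly (F : fieldType) (N : nat) (T : finType) (c : T -> F)
    (u : T -> {poly F}) :
  (forall t, (size (u t) <= N)%N) -> (size (\sum_t c t *: u t)%R <= N)%N.
Proof.
move=> su; apply: (leq_trans (size_sum _ _ _)); apply/bigmax_leqP => t _.
exact: leq_trans (size_scale_leq _ _) (su t).
Qed.

Lemma bivariate_of_coefs (F : fieldType) (s K I : nat) (c : 'I_K * 'I_I -> F) :
  exists A : {poly {poly F}},
    [/\ forall k, (size (A`_k)%R <= I)%N,
        A.['X^s] = \sum_ki c ki *: 'X^(s * ki.1 + ki.2) &
        A = 0 -> forall ki, c ki = 0].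
Proof.
(* Extension by zero, since [\poly] takes coefficients indexed by [nat]. *)
pose d k i := if insub k is Some k' then
  if insub i is Some i' then c (k', i') else 0 else 0.
have dE (k : 'I_K) (i : 'I_I) : d k i = c (k, i) by rewrite /d !valK.
exists (\poly_(k < K) \poly_(i < I) d k i); split.
- by move=> k; rewrite coef_poly; case: ifP; rewrite ?size_poly ?size_poly0.
- rewrite horner_poly.
  transitivity (\sum_(k < K) \sum_(i < I) c (k, i) *: 'X^(s * k + i)).
    apply: eq_bigr => k _; rewrite poly_def mulr_suml; apply: eq_bigr => i _.
    by rewrite dE -scalerAl -exprM -exprD addnC.
  by rewrite pair_bigA; apply: eq_bigr => -[].
move=> A0 [k i]; rewrite -dE.
have := congr1 (fun P : {poly {poly F}} => P`_k`_i) A0.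
by rewrite coef_poly ltn_ord coef_poly ltn_ord !coef0.
Qed.

(* Bombieri's form of Stepanov's method: with [c] solving the linear system
   [sum_t c_t g_t = 0], the polynomial [h = sum_t c_t^s u_t] satisfies
   [h(y)^s = sum_t c_t g_t(y) = 0] at every [y] of the set being counted. *)
Lemma stepanov_count (F : finFieldType) (s a e : nat) (f : {poly F}) (eps : F) :
  [pchar F].-nat s -> s = a.*2.+1 -> #|F| = (s ^ 2)%N -> (0 < e <= a)%N ->
  f \is monic -> size f = e.*2.+1 -> coprimep f f^`() ->
  (#|[set y | f.[y] ^+ (2 * a * a.+1) == eps]| * 2 <= s ^ 2 + (4 * e + 2) * s)%N.
Proof.
move=> hs sE cF he mf szf cop; have /andP[e0 ea] := he.
(* This [K] makes the [K (a+1) + K (a-e)] unknowns outnumber the [K + a s] coefficients available to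
   the [g t]. *)
pose K := (a + e).+2.
pose T := (('I_K * 'I_a.+1) + ('I_K * 'I_(a - e)))%type.
(* [g t] is [u t ^ s] reduced by [y^(s^2) = y] and [f(y)^(2a(a+1)) = eps], using
   [(a+1) s = 2a(a+1) + (a+1)]. *)
pose g (t : T) : {poly F} := match t with
  | inl ki => 'X^(ki.1 + s * ki.2)
  | inr ki => 'X^(ki.1 + s * ki.2) * (eps *: f ^+ a.+1) end.
pose u (t : T) : {poly F} := match t with
  | inl ki => 'X^(s * ki.1 + ki.2)
  | inr ki => 'X^(s * ki.1 + ki.2) * f ^+ a.+1 end.
have szfa : size (f ^+ a.+1) = (e.*2 * a.+1).+1.
  by rewrite polySpred ?expf_neq0 ?monic_neq0 // size_exp szf.
have [c [t0 ct0] cg] : exists2 c : T -> F, (exists t, c t != 0) & \sum_t c t *: g t = 0.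
  apply: (@lin_dep_polys _ _ (K + a * s)%N); last first.
    rewrite card_sum !card_prod !card_ord /K sE; nia.
  case=> [[k i]|[k j]] /=; have kK := ltn_ord k; rewrite /K in kK *.
    by have := ltn_ord i; rewrite size_polyXn; nia.
  have jJ := ltn_ord j.
  apply: (leq_trans (size_polyMleq _ _)); rewrite size_polyXn addSn /=.
  have := size_scale_leq eps (f ^+ a.+1); rewrite szfa.
  move: (size _) => m hm; move: (nat_of_ord k) (nat_of_ord j) kK jJ hm => k' j'.
  rewrite sE; clear -ea e0; nia.
pose h := \sum_t c t ^+ s *: u t.
have h0 : {in [set y | f.[y] ^+ (2 * a * a.+1) == eps], forall y, h.[y] = 0}.
  move=> y; rewrite inE => /eqP fy.
  suff : h.[y] ^+ s == 0 by rewrite expf_eq0 => /andP[_ /eqP].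
  rewrite /h horner_sum expr_sum_pchar //.
  apply/eqP; transitivity (\sum_t (c t *: g t).[y]); last by rewrite -horner_sum cg horner0.
  apply: eq_bigr => t _; rewrite !hornerZ exprMn -exprM mulnn -cF expf_card.
  have yQ n i : (y ^+ (s * n + i)) ^+ s = y ^+ (n + s * i).
    rewrite -exprM (_ : ((s * n + i) * s = s ^ 2 * n + s * i)%N); last by lia.
    by rewrite -cF !exprD exprM expf_card.
  congr (_ * _); case: t => [[k i]|[k j]] /=; first by rewrite !hornerXn yQ.
  rewrite !hornerM !hornerXn exprMn yQ hornerZ !horner_exp; congr (_ * _).
  rewrite -fy -exprM -exprD; congr (_ ^+ _); rewrite sE; clear; nia.
have szh : (size h <= a * s + (e.+1) * s + e * s + a.+1)%N.
  apply: size_bigsum_poly; case=> [[k i]|[k j]] /=.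
    rewrite size_polyXn; have := ltn_ord i; have := ltn_ord k; rewrite {2}/K sE.
    move: (nat_of_ord k) (nat_of_ord i) => k' i'; clear; nia.
  apply: (leq_trans (size_polyMleq _ _)); rewrite size_polyXn szfa addSn /=.
  have := ltn_ord j; have := ltn_ord k; rewrite {2}/K sE.
  move: (nat_of_ord k) (nat_of_ord j) => k' i'; clear -ea; nia.
have hn0 : h != 0.
  have [A [szA AE A0]] := bivariate_of_coefs s (fun ki : 'I_K * 'I_a.+1 => c (inl ki) ^+ s).
  have [B [szB BE B0]] := bivariate_of_coefs s (fun ki : 'I_K * 'I_(a - e) => c (inr ki) ^+ s).
  have hAB : h = A.['X^s] + f ^+ a.+1 * B.['X^s].
    rewrite /h big_sumType /= AE BE mulr_sumr; congr (_ + _).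
    by apply: eq_bigr => ki _; rewrite -scalerAr mulrC.
  apply/eqP => hh0.
  have [//|/A0 cA /B0 cB] := stepanov_aux_neq0 hs sE he mf szf cop szA szB.
    by rewrite -hAB.
  have : c t0 ^+ s = 0 by case: t0 {ct0}.
  by apply/eqP; rewrite expf_neq0.
have := leq_trans (poly_vanish_card hn0 h0) szh.
move: #|_| => n; rewrite sE; clear; nia.
Qed.

(** * Quadratic and additive characters *)

(* The quadratic character. *)
Definition eta (F : finFieldType) (x : F) : algC :=
  #|[set y : F | y ^+ 2 == x]|%:R - 1.

Lemma two_neq0 (F : finFieldType) : odd #|F| -> 2%:R != 0 :> F.
Proof.
move=> oF; have [p p_pr pF] := finPcharP F.
rewrite -(dvdn_pcharf pF); apply/negP => p2.
have pE : p = 2%N by apply/eqP; rewrite -(dvdn_prime2 p_pr).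
subst p; move: oF (finNzRing_gt1 F); rewrite (card_pprimeChar pF) oddX orbF.
by move/eqP=> ->.
Qed.

Lemma card_odd_expn (F : finFieldType) : odd #|F| -> (#|F|.-1 = 2 * (#|F|./2))%N.
Proof. by move=> oF; rewrite -[in LHS](odd_double_half #|F|) oF mul2n. Qed.

Lemma card_sqrt (F : finFieldType) (x : F) :
  #|[set y : F | y ^+ 2 == x]|%:R = 1 + eta x.
Proof. by rewrite addrC subrK. Qed.

Lemma eta0 (F : finFieldType) : eta (0 : F) = 0.
Proof.
rewrite /eta (_ : [set y | _] = [set 0]) ?cards1 ?subrr //.
by apply/setP => y; rewrite !inE expf_eq0.
Qed.

Lemma eta_sqr (F : finFieldType) (y : F) : odd #|F| -> y != 0 -> eta (y ^+ 2) = 1.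
Proof.
move=> oF y0; rewrite /eta (_ : [set z | _] = [set y; - y]); last first.
  by apply/setP => z; rewrite !inE eqf_sqr.
rewrite cards2; suff -> : y != - y by rewrite (natrD _ 1 1) addrK.
by rewrite -subr_eq0 opprK -mulr2n -mulr_natl mulf_neq0 ?two_neq0.
Qed.

Lemma eta_nsqr (F : finFieldType) (x : F) : (forall y, y ^+ 2 != x) -> eta x = -1.
Proof.
move=> nx; rewrite /eta (_ : [set z | _] = set0) ?cards0 ?sub0r //.
by apply/setP => z; rewrite !inE (negbTE (nx z)).
Qed.

(** Euler's criterion. If [x^((q-1)/2) = 1] and [x = g^i] with [g] a generator of the cyclic unit
    group, the order [q - 1] of [g] forces [i] to be even. *)
Lemma etaP (F : finFieldType) (x : F) : odd #|F| ->
  [\/ x = 0 /\ eta x = 0,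
      [/\ x != 0, x ^+ #|F|./2 = 1 & eta x = 1] |
      [/\ x != 0, x ^+ #|F|./2 = -1 & eta x = -1]].
Proof.
move=> oF; have [->|x0] := eqVneq x 0; first by apply: Or31; rewrite eta0.
have xN : (x ^+ #|F|./2) ^+ 2 = 1.
  rewrite -exprM mulnC -card_odd_expn //; apply: (mulfI x0).
  by rewrite mulr1 -exprS prednK ?expf_card // ltnW ?finNzRing_gt1.
case: (pickP [pred y : F | y ^+ 2 == x]) => /= [y /eqP yx|nx].
  have y0 : y != 0 by apply: contraNneq x0 => y0; rewrite -yx y0 expr0n.
  apply: Or32; split=> //; last by rewrite -yx eta_sqr.
  rewrite -yx -exprM -card_odd_expn //; apply: (mulfI y0).
  by rewrite mulr1 -exprS prednK ?expf_card // ltnW ?finNzRing_gt1.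
apply: Or33; split=> //; last by apply: eta_nsqr => y; have /= -> := nx y.
move/eqP: xN; rewrite sqrf_eq1 => /orP[/eqP x1|/eqP //].
have /cyclicP[g gE] := field_unit_group_cyclic [set: {unit F}].
have Ux : x \is a GRing.unit by rewrite unitfE.
have : FinRing.unit F Ux \in <[g]>%g by rewrite -gE inE.
case/cycleP => i gi.
have og : #[g]%g = (2 * #|F|./2)%N by rewrite -card_odd_expn // orderE -gE card_finField_unit.
have /eqP : (g ^+ (i * #|F|./2))%g = 1%g.
  by apply: val_inj; rewrite expgM -gi FinRing.val_unitX /= x1.
rewrite -order_dvdn og dvdn_pmul2r => [/dvdnP[j ij]|]; last first.
  by have := finNzRing_gt1 F; case: #|F| => [|[|n]].
have : val g ^+ j ^+ 2 == x.
  by rewrite -exprM -ij -FinRing.val_unitX -gi.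
by have /= -> := nx (val g ^+ j).
Qed.

Lemma eta_norm_le1 (F : finFieldType) (x : F) : odd #|F| -> `|eta x| <= 1.
Proof.
by move=> oF; have [[_ ->]|[_ _ ->]|[_ _ ->]] := etaP x oF; rewrite ?normrN ?normr0 ?normr1.
Qed.

Lemma etaM (F : finFieldType) (x y : F) : odd #|F| -> eta (x * y) = eta x * eta y.
Proof.
move=> oF.
have n11 : 1 <> -1 :> F.
  by move/eqP; rewrite -subr_eq0 opprK; apply/negP; rewrite two_neq0.
have [[-> ->]|[x0 xN ->]|[x0 xN ->]] := etaP x oF; first by rewrite !mul0r eta0.
all: have [[-> ->]|[y0 yN ->]|[y0 yN ->]] := etaP y oF; first by rewrite !mulr0 eta0.
all: have [[/eqP + _]|[_ + ->]|[_ + ->]] := etaP (x * y) oF; 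
  rewrite ?mulf_eq0 ?(negbTE x0) ?(negbTE y0) //.
all: rewrite exprMn xN yN ?mulN1r ?mul1r ?opprK //.
all: by move=> h; case: n11; rewrite h.
Qed.

Lemma eta_neq0 (F : finFieldType) (x : F) : odd #|F| -> x != 0 -> eta x ^+ 2 = 1.
Proof.
move=> oF; have [[-> _]|[_ _ ->]|[_ _ ->]] := etaP x oF; rewrite ?eqxx ?sqrrN ?expr1n //.
Qed.

(** Otherwise [X^((q-1)/2) - 1] would have [q - 1] roots. *)
Lemma exists_nonsquare (F : finFieldType) : odd #|F| -> exists x : F, eta x = -1.
Proof.
move=> oF; case: (pickP [pred x : F | eta x == -1]) => /= [x /eqP|h]; first by exists x.
exfalso.
have h1 (x : F) : x != 0 -> x ^+ #|F|./2 = 1.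
  move=> x0; have [[/eqP]|[_ -> //]|[_ _ /eqP]] := etaP x oF; last by have /= -> := h x.
  by rewrite (negbTE x0).
have : (#|[set~ 0%R : F]| < size ('X^(#|F|./2) - 1 : {poly F})%R)%N.
  apply: poly_vanish_card.
    have g0 : (0 < #|F|./2)%N by have := finNzRing_gt1 F; case: #|F| => [|[|n]].
    by rewrite -size_poly_eq0 size_XnsubC.
  by move=> y; rewrite !inE => /h1 hy; rewrite !hornerE ?hornerXn hy subrr.
rewrite cardsC1 card_odd_expn // size_XnsubC; last first.
  by have := finNzRing_gt1 F; case: #|F| => [|[|n]].
have := finNzRing_gt1 F; move: oF; move: #|F| => n; lia.
Qed.

(** Stepanov's method bounds counts only from above. But the points where [eta f.[y]] is [1], [-1]
    or [0] partition the field and the zeros are few, so the upper bound for [1] bounds the sum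
    above and the one for [-1] bounds it below. *)
Lemma eta_sum_bound (F : finFieldType) (s a e : nat) (f : {poly F}) :
  [pchar F].-nat s -> s = a.*2.+1 -> #|F| = (s ^ 2)%N -> (0 < e <= a)%N ->
  f \is monic -> size f = e.*2.+1 -> coprimep f f^`() ->
  `|\sum_y eta f.[y]| <= ((4 * e + 3) * s)%:R.
Proof.
move=> hs sE cF he mf szf cop; have /andP[e0 ea] := he.
have oF : odd #|F| by rewrite cF sE oddX /= odd_double.
(* Euler's exponent is the one counted in [stepanov_count]. *)
have half : (#|F|./2 = 2 * a * a.+1)%N.
  have := card_odd_expn oF; rewrite cF sE; move: (_./2) => m; rewrite -subn1; nia.
pose n (eps : F) := #|[set y | f.[y] ^+ (2 * a * a.+1) == eps]|.
pose n0 := #|[set y | f.[y] == 0]|.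
have hn eps : (n eps * 2 <= s ^ 2 + (4 * e + 2) * s)%N by apply: stepanov_count.
have hn0 : (n0 < s)%N.
  have := @poly_vanish_card F f [set y | f.[y] == 0] (monic_neq0 mf).
  rewrite szf sE => h; apply: (@leq_trans e.*2.+1); last by lia.
  by apply: h => y; rewrite inE => /eqP.
have cnt (P : pred F) : #|[set y | P y]|%:R = \sum_y (P y)%:R :> algC.
  by rewrite -sum1dep_card natr_sum big_mkcond; apply: eq_bigr => y _; case: (P y).
have n11 : (1 == -1 :> F) = false.
  by apply/negbTE; rewrite -subr_eq0 opprK two_neq0.
have hN : (0 < 2 * a * a.+1)%N by lia.
have z1 : (0 == 1 :> F) = false by rewrite eq_sym oner_eq0.
have z2 : (0 == -1 :> F) = false by rewrite eq_sym oppr_eq0 oner_eq0.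
have S1 : \sum_y eta f.[y] = (s ^ 2)%:R - n0%:R - 2%:R * (n (-1))%:R.
  rewrite /n /n0 !cnt -cF -sum1_card natr_sum mulr_sumr -!sumrB; apply: eq_bigr => y _.
  have [[-> ->]|[y0 yN ->]|[y0 yN ->]] := etaP f.[y] oF; rewrite -?half ?yN ?(negbTE y0).
  - by rewrite expr0n eqxx half eqn0Ngt hN /= ?mulr0n z2 /=; ring.
  - by rewrite n11 /=; ring.
  - by rewrite eqxx /=; ring.
have S2 : \sum_y eta f.[y] = - (s ^ 2)%:R + n0%:R + 2%:R * (n 1)%:R.
  rewrite /n /n0 !cnt -cF -sum1_card natr_sum mulr_sumr -sumrN -!big_split; apply: eq_bigr => y _ /=.
  have [[-> ->]|[y0 yN ->]|[y0 yN ->]] := etaP f.[y] oF; rewrite -?half ?yN ?(negbTE y0).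
  - by rewrite expr0n eqxx half eqn0Ngt hN /= ?mulr0n z1 /=; ring.
  - by rewrite eqxx /=; ring.
  - by rewrite eq_sym n11 /=; ring.
have real_sum : \sum_y eta f.[y] \is Num.real.
  by rewrite S1 !rpredB // ?rpredM // realn.
have b1 := hn (-1); have b2 := hn 1.
rewrite real_ler_norml //; apply/andP; split; rewrite -subr_ge0.
  rewrite S1 (_ : _ - - _ = ((4 * e + 3) * s + s ^ 2)%:R - (n0 + n (- 1)%R * 2)%:R).
    by rewrite subr_ge0 ler_nat; clear -b1 hn0; lia.
  by rewrite !natrD !natrM; ring.
rewrite S2 (_ : _ - _ = ((4 * e + 3) * s + s ^ 2)%:R - (n0 + n 1%R * 2)%:R).
  by rewrite subr_ge0 ler_nat; clear -b2 hn0; lia.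
by rewrite !natrD !natrM; ring.
Qed.

Definition add_char (F : finFieldType) (psi : F -> algC) :=
  [/\ {morph psi : x y / x + y >-> x * y}, psi 0 = 1 & exists x, psi x != 1].

(** The kernels of the irreducible characters of the additive group intersect trivially, so some
    kernel misses [1]; that character is linear, the group being abelian. *)
Lemma add_char_exists (F : finFieldType) : exists psi : F -> algC, add_char psi.
Proof.
have ab : abelian [set: F] by apply: FinRing.Theory.zmod_abelian.
have [i hi] : exists i : Iirr [set: F]%G, (1%R : F) \notin cfker 'chi_i.
  apply/existsP; rewrite -negb_forall; apply/negP => /forallP h.
  have : (1%R : F) \in \bigcap_i cfker 'chi[[set: F]%G]_i by apply/bigcapP => i _.
  by rewrite TI_cfker_irr inE FinRing.Theory.zmod1gE oner_eq0.
have lin : 'chi_i \is a linear_char by apply: (char_abelianP _ _).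
exists 'chi_i; split.
- by move=> x y; rewrite -lin_charM ?inE.
- by rewrite -FinRing.Theory.zmod1gE lin_char1.
exists 1; apply: contra hi; rewrite cfkerEchar ?lin_charW // inE lin_char1 // inE => ->.
by [].
Qed.

Section AddChar.
Variables (F : finFieldType) (psi : F -> algC).
Hypothesis psiP : add_char psi.

Lemma add_charD x y : psi (x + y) = psi x * psi y.
Proof. by case: psiP. Qed.

Lemma add_char0 : psi 0 = 1.
Proof. by case: psiP. Qed.

Lemma add_charMn x n : psi (x *+ n) = psi x ^+ n.
Proof. by elim: n => [|n IH]; rewrite ?add_char0 // mulrSr add_charD IH exprSr. Qed.

Lemma add_char_norm x : `|psi x| = 1.
Proof.
have [p p_pr pF] := finPcharP F.
have : psi x ^+ p = 1 by rewrite -add_charMn -mulr_natr (pcharf0 pF) mulr0 add_char0.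
move/(congr1 Num.norm); rewrite normrX normr1 => /eqP.
by rewrite pexpr_eq1 ?normr_ge0 // ?prime_gt0 // => /eqP.
Qed.

Lemma add_charN x : psi (- x) = (psi x)^*.
Proof.
have xn0 : psi x != 0 by rewrite -normr_eq0 add_char_norm oner_eq0.
apply: (mulfI xn0); rewrite -add_charD subrr add_char0.
by rewrite -normCK add_char_norm expr1n.
Qed.

Lemma add_char_sum (c : F) : \sum_x psi (c * x) = (#|F| * (c == 0))%:R.
Proof.
have [->|c0] := eqVneq c 0.
  under eq_bigr do rewrite mul0r add_char0.
  by rewrite muln1 sumr_const.
have [_ _ [z z1]] := psiP.
rewrite muln0; set S := LHS.
(* Translating the summation variable by [z / c] multiplies [S] by [psi z], which is not [1]. *)
have : psi z * S = S.
  rewrite /S mulr_sumr [RHS](reindex_inj (addrI (c^-1 * z))) /=.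
  by apply: eq_bigr => x _; rewrite mulrDr mulrA divff // mul1r add_charD.
move/eqP; rewrite -subr_eq0 -{2}[S]mul1r -mulrBl mulf_eq0 subr_eq0 (negbTE z1).
by move=> /eqP.
Qed.

Lemma add_char_sum0 : \sum_x psi x = 0.
Proof.
rewrite -[RHS](_ : (#|F| * (1 == 0 :> F))%:R = 0) -?add_char_sum.
  by apply: eq_bigr => x _; rewrite mul1r.
by rewrite add_char_sum oner_eq0 muln0.
Qed.
End AddChar.

(** * Kloosterman sums and Weil's bound *)

Definition kloosterman (F : finFieldType) (psi : F -> algC) (a b : F) : algC :=
  \sum_(x | x != 0) psi (a * x + b / x).

Lemma sum_fibers (I J : finType) (h : I -> J) (G : J -> algC) (P : pred J) :
  \sum_(i | P (h i)) G (h i) = \sum_(j | P j) #|[set i | h i == j]|%:R * G j.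
Proof.
rewrite (partition_big h P) //=; apply: eq_bigr => j Pj.
rewrite (eq_bigl (fun i => h i == j)); last first.
  by move=> i /=; case: eqP => [->|]; rewrite ?Pj ?andbF.
rewrite (eq_bigr (fun=> G j)); last by move=> i /eqP ->.
by rewrite sumr_const mulr_natl cardsE.
Qed.

(** Sort the [x] by [v = a x + b / x]: they are the roots of [a x^2 - v x + b], and their number is
    [1] plus [eta] of the discriminant. The [1] disappears since [psi] sums to zero. *)
Lemma kloosterman_eta (F : finFieldType) (psi : F -> algC) (a b : F) :
  odd #|F| -> add_char psi -> a != 0 -> b != 0 ->
  kloosterman psi a b = \sum_v psi v * eta (v ^+ 2 - 4%:R * a * b).
Proof.
move=> oF psiP a0 b0; have n2 := two_neq0 oF.
have n4 : 4%:R != 0 :> F by rewrite (natrM _ 2 2) mulf_neq0.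
have -> : \sum_v psi v * eta (v ^+ 2 - 4%:R * a * b) =
    \sum_v #|[set y : F | y ^+ 2 == v ^+ 2 - 4%:R * a * b]|%:R * psi v.
  under [RHS]eq_bigr do rewrite card_sqrt mulrDl mul1r.
  rewrite big_split /= (add_char_sum0 psiP) add0r.
  by apply: eq_bigr => v _; rewrite mulrC.
rewrite /kloosterman (partition_big (fun x => a * x + b / x) predT) //=.
apply: eq_bigr => v _.
rewrite (eq_bigr (fun=> psi v)); last by move=> x /andP[_ /eqP ->].
rewrite sumr_const mulr_natl; congr (_ *+ _).
(* This map sends the roots to the square roots of the discriminant. *)
have inj : injective (fun x => 2%:R * a * x - v).
  by move=> x y /addIr; apply: mulfI; rewrite mulf_neq0.
rewrite -(card_preimset _ inj); apply: eq_card => x; rewrite !inE unfold_in.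
rewrite -[RHS]subr_eq0.
have [->|x0] := eqVneq x 0 => /=.
  rewrite (_ : _ - _ = 4%:R * a * b); last by ring.
  by rewrite !mulf_eq0 (negbTE a0) (negbTE b0) (negbTE n4).
rewrite [X in _ = (X == 0)](_ : _ = 4%:R * a * x * (a * x + b / x - v)); last by field.
rewrite !mulf_eq0 (negbTE a0) (negbTE x0) (negbTE n4) /=.
by rewrite subr_eq0.
Qed.

Lemma card_conic_fiber (F : finFieldType) (D x v : F) : odd #|F| -> D != 0 ->
  #|[set y : F | x ^+ 2 - D * y ^+ 2 == v]|%:R = 1 + eta D * eta (x ^+ 2 - v).
Proof.
move=> oF D0.
have eV : eta D^-1 = eta D.
  have := etaM D D^-1 oF; rewrite divff // -[X in eta X](expr1n F 2) eta_sqr ?oner_eq0 //.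
  have := eta_neq0 oF D0; rewrite expr2 => h h1.
  by rewrite -[LHS]mul1r -h -mulrA -h1 mulr1.
rewrite -eV -etaM // -card_sqrt; congr (_%:R); apply: eq_card => y; rewrite !inE.
by apply/eqP/eqP => [<-|->]; field.
Qed.

(** Used for [D = 1], where [x^2 - D y^2] is the product of [x + y] and [x - y], and for [D] a
    nonsquare, where it is a norm from the quadratic extension. The two cases differ only in the
    sign [eta D]. *)
Lemma sum_conic (F : finFieldType) (D : F) (G : F -> F -> algC) : odd #|F| -> D != 0 ->
  \sum_x \sum_(y | x ^+ 2 - D * y ^+ 2 != 0) G x (x ^+ 2 - D * y ^+ 2) =
  \sum_x \sum_(v | v != 0) (1 + eta D * eta (x ^+ 2 - v)) * G x v.
Proof.
move=> oF D0; apply: eq_bigr => x _.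
rewrite (@sum_fibers _ _ (fun y => x ^+ 2 - D * y ^+ 2) (G x) (fun v => v != 0)).
by apply: eq_bigr => v _; rewrite card_conic_fiber.
Qed.

(* Substitute [u = x + y], [v = x - y] in the double sum over [u] and [v]. *)
Lemma kloosterman_sqr (F : finFieldType) (psi : F -> algC) (a b : F) :
  odd #|F| -> add_char psi ->
  kloosterman psi a b ^+ 2 = \sum_x \sum_(v | v != 0)
    (1 + eta (x ^+ 2 - v)) * psi (2%:R * x * (a + b / v)).
Proof.
move=> oF psiP; have n2 := two_neq0 oF.
have e1 : eta (1 : F) = 1 by rewrite -(expr1n F 2) eta_sqr ?oner_eq0.
transitivity (\sum_x \sum_(y | x ^+ 2 - 1 * y ^+ 2 != 0)
    psi (2%:R * x * (a + b / (x ^+ 2 - 1 * y ^+ 2)))); last first.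
  rewrite (@sum_conic _ 1 (fun x v => psi (2%:R * x * (a + b / v)))) ?oner_eq0 //.
  by rewrite e1; under eq_bigr do under eq_bigr do rewrite mul1r.
rewrite pair_big_dep /= [LHS]expr2 /kloosterman mulr_suml.

under [LHS]eq_bigr => i _ do rewrite mulr_sumr.
rewrite pair_big_dep /=.
rewrite (reindex (fun p : F * F => (p.1 + p.2, p.1 - p.2))) /=; last first.
  exists (fun p => ((p.1 + p.2) / 2%:R, (p.1 - p.2) / 2%:R)) => -[x y] _ /=; congr pair; by field.
have N x y : x ^+ 2 - 1 * y ^+ 2 = (x + y) * (x - y) :> F by ring.
apply: eq_big => -[x y] /=; first by rewrite N mulf_eq0 negb_or.
case/andP=> h1 h2; rewrite -add_charD // N; congr psi.
by field; rewrite h1 h2.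
Qed.

(** * Norm, trace and Kloosterman sums in a quadratic extension *)

Section QuadraticExtension.
Variables (F L : finFieldType) (iota : {rmorphism F -> L}) (theta : L) (eps : F).
Variables (re im : L -> F) (psi : F -> algC).
Hypothesis oF : odd #|F|.
Hypothesis eps_nsq : eta eps = -1.
Hypothesis thetaE : theta ^+ 2 = iota eps.
Hypothesis coordK : forall z, iota (re z) + iota (im z) * theta = z.
Hypothesis reK : forall x y, re (iota x + iota y * theta) = x.
Hypothesis imK : forall x y, im (iota x + iota y * theta) = y.
Hypothesis psiP : add_char psi.

(** [2 re z] is the trace of [z], so this is [psi] composed with the trace. *)
Let psiL z := psi (2%:R * re z).

Lemma quad_reD x y : re (x + y) = re x + re y.
Proof.
rewrite -{1}(coordK x) -{1}(coordK y) addrACA -mulrDl -!rmorphD; exact: reK.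
Qed.

Lemma quad_reZ a z : re (iota a * z) = a * re z.
Proof. by rewrite -{1}(coordK z) mulrDr mulrA -!rmorphM reK. Qed.

Lemma quad_re_iota a : re (iota a) = a.
Proof. by rewrite -[iota a]addr0 -(mul0r theta) -(rmorph0 iota) reK. Qed.

Lemma quad_card : #|L| = (#|F| ^ 2)%N.
Proof.
rewrite -mulnn -card_prod; apply: (@bij_eq_card _ _ (fun z => (re z, im z))).
exists (fun p => iota p.1 + iota p.2 * theta) => [z|[x y]] /=; first exact: coordK.
by rewrite reK imK.
Qed.

Lemma quad_add_char : add_char psiL.
Proof.
split=> [x y||]; rewrite /psiL.
- by rewrite quad_reD mulrDr add_charD.
- by rewrite -(rmorph0 iota) quad_re_iota mulr0 add_char0.
have [_ _ [x x1]] := psiP; exists (iota (x / 2%:R)).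
by rewrite quad_re_iota mulrC divfK ?two_neq0.
Qed.

Lemma quad_norm x y : (iota x + iota y * theta) * (iota x - iota y * theta) =
  iota (x ^+ 2 - eps * y ^+ 2).
Proof.
by rewrite !expr2 rmorphB !rmorphM -thetaE; ring.
Qed.

Lemma quad_eq0 x y : (iota x + iota y * theta == 0) = ((x == 0) && (y == 0)).
Proof.
apply/eqP/andP => [h|[/eqP-> /eqP->]]; last by rewrite rmorph0 mul0r addr0.
have := reK x y; have := imK x y; rewrite h.
have := reK 0 0; have := imK 0 0; rewrite rmorph0 mul0r addr0 => -> -> <- <-.
by rewrite eqxx.
Qed.

Lemma quad_norm_eq0 x y : (x ^+ 2 - eps * y ^+ 2 == 0) = ((x == 0) && (y == 0)).
Proof.
rewrite -(fmorph_eq0 iota) -quad_norm mulf_eq0 quad_eq0.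
by rewrite -mulNr -rmorphN quad_eq0 oppr_eq0 orbb.
Qed.

(* An element of half-trace [x] and norm [v] exists in [1 - eta (x ^ 2 - v)] ways,
   a pair of elements of [F] with half-sum [x] and product [v] in
   [1 + eta (x ^ 2 - v)] ways; in the sum of both the character [eta] cancels. *)
Lemma quad_kloosterman a b : a != 0 -> b != 0 ->
  kloosterman psiL (iota a) (iota b) = 2%:R * #|F|%:R - kloosterman psi a b ^+ 2.
Proof.
move=> a0 b0; have n2 := two_neq0 oF.
have eps0 : eps != 0.
  by apply/eqP => e0; move: eps_nsq; rewrite e0 eta0 => /eqP; rewrite eq_sym oppr_eq0 oner_eq0.
have -> : kloosterman psiL (iota a) (iota b) =
    \sum_x \sum_(v | v != 0) (1 - eta (x ^+ 2 - v)) * psi (2%:R * x * (a + b / v)).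
  transitivity (\sum_x \sum_(y | x ^+ 2 - eps * y ^+ 2 != 0)
      psi (2%:R * x * (a + b / (x ^+ 2 - eps * y ^+ 2)))); last first.
    rewrite (@sum_conic _ eps (fun x v => psi (2%:R * x * (a + b / v)))) //.
    by rewrite eps_nsq; under eq_bigr do under eq_bigr do rewrite mulN1r.
  rewrite pair_big_dep /= /kloosterman.
  rewrite (reindex (fun p : F * F => iota p.1 + iota p.2 * theta)) /=; last first.
    exists (fun z => (re z, im z)) => [[x y] _|z _] /=; last exact: coordK.
    by rewrite reK imK.
  apply: eq_big => -[x y] /=; first by rewrite quad_eq0 quad_norm_eq0.
  rewrite quad_eq0 -quad_norm_eq0 => N0; rewrite /psiL; congr psi.
  rewrite -mulrA; congr (_ * _).
  (* The inverse is the conjugate divided by the norm. *)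
  have -> : iota b / (iota x + iota y * theta) =
      iota (b / (x ^+ 2 - eps * y ^+ 2)) * (iota x + iota (- y) * theta).
    have z0 : iota x + iota y * theta != 0 by rewrite quad_eq0 -quad_norm_eq0.
    apply: (mulIf z0); rewrite divfK // -mulrA [X in _ * X]mulrC rmorphN mulNr quad_norm.
    by rewrite -rmorphM divfK.
  by rewrite quad_reD !quad_reZ !reK; ring.
rewrite kloosterman_sqr //; set A := LHS; set B := \sum_x _.
suff : A + B = 2%:R * #|F|%:R by move=> <-; rewrite addrK.
rewrite /A /B -big_split /=.
transitivity (\sum_x \sum_(v | v != 0) 2%:R * psi (2%:R * (a + b / v) * x)).
  apply: eq_bigr => x _; rewrite -big_split /=; apply: eq_bigr => v _.
  by rewrite [2 * x * _]mulrAC -mulrDl; congr (_ * _); ring.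
(* Orthogonality in [x] leaves only [v = - b / a], which contributes [2 q]. *)
rewrite exchange_big /= (bigD1 (- b / a)) /=; last by rewrite mulf_neq0 ?oppr_eq0 ?invr_eq0.
rewrite -mulr_sumr add_char_sum // big1 ?addr0.
  rewrite (_ : _ == 0) ?muln1 //.
  by apply/eqP; field; rewrite ?oppr_eq0 a0 b0.
move=> v /andP[v0 vba]; rewrite -mulr_sumr add_char_sum // (_ : _ == 0 = false) ?muln0 ?mulr0 //.
rewrite mulf_eq0 (negbTE n2) /=; apply: contraNF vba => /eqP h.
by apply/eqP; rewrite -[b](divfK v0) -(addr0_eq h); field.
Qed.

(** For [n] odd, [theta^n] is an element of [F] times [theta], so [re] commutes with the power [n]
    of Frobenius type. Invariance of the character thus passes up the tower. *)
Lemma quad_frobenius n : [pchar F].-nat n -> odd n ->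
  (forall x, psi (x ^+ n) = psi x) -> forall z, psiL (z ^+ n) = psiL z.
Proof.
move=> hn on hpsi z; rewrite /psiL.
have hnL : [pchar L].-nat n by rewrite (eq_pnat _ (fmorph_pchar iota)).
suff -> : re (z ^+ n) = re z ^+ n.
  by rewrite !mulr_natl !mulr2n -exprDn_pchar // hpsi.
rewrite -{1}(coordK z) exprDn_pchar // exprMn -!rmorphXn /=.
rewrite -[in theta ^+ n](odd_double_half n) on exprD expr1 -muln2 mulnC exprM thetaE.
by rewrite mulrCA -rmorphXn -rmorphM mulrC reK.
Qed.

End QuadraticExtension.

(** [L] is [F[X]] modulo [X^2 - eps] with [eps] a nonsquare, and [re], [im] are the coefficients of
    the reduced representative. *)
Lemma quad_ext (F : finFieldType) (psi : F -> algC) : odd #|F| -> add_char psi ->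
  exists (L : finFieldType) (psiL : L -> algC) (iota : {rmorphism F -> L}),
    [/\ add_char psiL, #|L| = (#|F| ^ 2)%N,
       forall a b, a != 0 -> b != 0 ->
         kloosterman psiL (iota a) (iota b) = 2%:R * #|F|%:R - kloosterman psi a b ^+ 2 &
       forall n, [pchar F].-nat n -> odd n -> (forall x, psi (x ^+ n) = psi x) ->
         forall z, psiL (z ^+ n) = psiL z].
Proof.
move=> oF psiP; have [eps eps_nsq] := exists_nonsquare oF.
pose h : {poly F} := 'X^2 - eps%:P.
have szh : size h = 3 by rewrite size_XnsubC.
have mh : h \is monic by rewrite monicXnsubC.
have nroot x : ~~ root h x.
  rewrite rootE !hornerE ?hornerXn subr_eq0; apply/eqP => xe.
  have x0 : x != 0.
    by apply: contra_eq_neq eps_nsq => x0; rewrite -xe x0 expr0n eta0 eq_sym oppr_eq0 oner_eq0.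
  have := eta_sqr oF x0; rewrite xe eps_nsq => /eqP.
  by rewrite eq_sym -subr_eq0 opprK -mulr2n pnatr_eq0.
have ih : irreducible_poly h by apply: cubic_irreducible; rewrite ?szh.
pose hI : monic_irreducible_poly h := (ih, mh).
pose L : finFieldType := {poly %/ h with hI}.
pose iota : {rmorphism F -> L} := qpolyC h.
pose theta : L := qpolyX h.
have mkE : mk_monic h = h by rewrite /mk_monic szh mh.
have iE x : (iota x : {poly F}) = x%:P by [].
have tE : (theta : {poly F}) = 'X by rewrite /theta qpolyXE ?szh.
have szL (z : L) : (size (z : {poly F}) <= 2)%N.
  have lt_z : (size (z : {poly F}) < size (mk_monic h))%N := size_mk_monic z.
  by rewrite -ltnS (leq_trans lt_z) // mkE szh.
have mulE (x y : L) : (x * y : L) =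
    Pdiv.CommonRing.rmodp ((x : {poly F}) * (y : {poly F})) h :> {poly F}.
  by rewrite poly_of_qpolyM; congr Pdiv.CommonRing.rmodp.
have ztE x : (iota x * theta : L) = x *: 'X :> {poly F}.
  rewrite mulE iE tE mul_polyC Pdiv.CommonRing.rmodp_small // szh ltnS.
  by rewrite (leq_trans (size_scale_leq _ _)) // size_polyX.
have theta2 : theta ^+ 2 = iota eps.
  rewrite expr2; apply: val_inj; apply: (etrans (mulE theta theta)).
  rewrite tE -expr2 (_ : 'X^2 = 1 * h + eps%:P); last first.
    by rewrite mul1r subrK.
  by rewrite Pdiv.RingMonic.rmodp_addl_mul_small // szh size_polyC ltnS (leq_trans (leq_b1 _)).
pose re (z : L) : F := (z : {poly F})`_0.
pose im (z : L) : F := (z : {poly F})`_1.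
have valE x y : (iota x + iota y * theta : L) = x%:P + y *: 'X :> {poly F}.
  by rewrite -ztE.
have reK x y : re (iota x + iota y * theta) = x.
  by rewrite /re valE coefD coefC coefZ coefX mulr0 addr0.
have imK x y : im (iota x + iota y * theta) = y.
  by rewrite /im valE coefD coefC coefZ coefX mulr1 add0r.
have coordK z : iota (re z) + iota (im z) * theta = z.
  apply: val_inj; apply: (etrans (valE _ _)); apply/polyP => -[|[|i]].
  - by rewrite coefD coefC coefZ coefX mulr0 addr0.
  - by rewrite coefD coefC coefZ coefX mulr1 add0r.
  by rewrite coefD coefC coefZ coefX mulr0 addr0 nth_default // (leq_trans (szL z)).
exists L, (fun z => psi (2%:R * re z)), iota; split.
- exact: (quad_add_char oF coordK reK psiP).
- exact: (quad_card coordK reK imK).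
- by move=> a b a0 b0; apply: (quad_kloosterman oF eps_nsq theta2 coordK reK imK psiP).
exact: (quad_frobenius theta2 coordK reK).
Qed.

Lemma pchar_nat_card (F : finFieldType) : [pchar F].-nat #|F|.
Proof.
have [p p_pr pF] := finPcharP F.
rewrite (eq_pnat _ (pcharf_eq pF)) (card_pprimeChar pF) pnatX pnat_id //.
Qed.

(* [psi] is invariant under the shifts [v -> v + (y^q - y)]; averaging over [y]
   replaces the twisted sum by sums of [eta] over values of a polynomial. *)
Lemma kloosterman_stepanov (L : finFieldType) (psi : L -> algC) (q s a : nat) (x y : L) :
  add_char psi -> [pchar L].-nat s -> [pchar L].-nat q -> (1 < q <= a)%N ->
  s = a.*2.+1 -> #|L| = (s ^ 2)%N -> (forall z, psi (z ^+ q) = psi z) ->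
  x != 0 -> y != 0 -> `|kloosterman psi x y| <= ((4 * q + 3) * s)%:R.
Proof.
move=> psiP hs hq /andP[q1 qa] sE cL hpsi x0 y0.
have oL : odd #|L| by rewrite cL sE oddX /= odd_double.
rewrite kloosterman_eta //; set c := 4%:R * x * y.
have c0 : c != 0 by rewrite !mulf_neq0 // (natrM _ 2 2) mulf_neq0 // two_neq0.
(* [f v] at [z] is [(v + z^q - z)^2 - c], the argument of [eta] after the shift by [z^q - z]. *)
pose G (v : L) : {poly L} := 'X^q - ('X - v%:P).
pose f v := G v ^+ 2 - c%:P.
have szG v : size (G v) = q.+1.
  by rewrite /G size_polyDl size_polyXn // size_polyN size_XsubC ltnS.
have mG v : G v \is monic.
  by rewrite monicE /G lead_coefDl ?lead_coefXn // size_polyN size_XsubC size_polyXn ltnS.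
have szG2 v : size (G v ^+ 2) = q.*2.+1.
  by rewrite size_monicM ?mG ?monic_neq0 // szG addnS /= addSn addnn.
have mf v : f v \is monic.
  rewrite monicE /f lead_coefDl; first by rewrite (monicP _) // monic_exp.
  by rewrite size_polyN size_polyC szG2 (leq_ltn_trans (leq_b1 _)) // ltnS double_gt0 ltnW.
have szf v : size (f v) = q.*2.+1.
  rewrite /f size_polyDl // size_polyN size_polyC szG2.
  by rewrite (leq_ltn_trans (leq_b1 _)) // ltnS double_gt0 ltnW.
have q0L : q%:R = 0 :> L.
  have pL : pdiv q \in [pchar L] by rewrite (pnatPpi hq) // pi_pdiv.
  by apply/eqP; rewrite -(dvdn_pcharf pL) pdiv_dvd.
have G' v : (G v)^`() = -1.
  by rewrite /G derivB derivXn derivXsubC -scaler_nat q0L scale0r sub0r.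
(* Since [G' = -1], the derivative of [f] is [-2 G], and a common divisor of [f] and [G] divides the
   nonzero constant [c]. *)
have cop v : coprimep (f v) (f v)^`().
  have -> : (f v)^`() = - (2%:R *: G v).
    by rewrite /f derivB derivC subr0 expr2 derivM G' mulrN1 mulN1r -opprD -mulr2n scaler_nat.
  apply/coprimepP => d df; rewrite dvdpNr dvdpZr ?two_neq0 // => dG.
  have dc : d %| c%:P.
    rewrite (_ : c%:P = G v ^+ 2 - f v); last by rewrite /f opprB addrC subrK.
    by rewrite dvdp_sub // expr2 dvdp_mulr.
  by apply: (dvdp_eqp1 dc); rewrite polyC_eqp1.
have bnd v : `|\sum_z eta (f v).[z]| <= ((4 * q + 3) * s)%:R.
  by apply: (@eta_sum_bound _ s a q) => //; rewrite ltnW.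
have shift z w : psi (w + (z ^+ q - z)) = psi w.
  by rewrite !add_charD // hpsi -add_charD // subrr add_char0 // mulr1.
set K := \sum_v _.
have sh (z v : L) : z ^+ q - (z - v) = v + (z ^+ q - z) by ring.
have Q0 : 0 < #|L|%:R :> algC by rewrite ltr0n ltnW ?finNzRing_gt1.
(* Every [z] gives a shift that rewrites [K]; these [|L|] expressions are added up and the sums
   exchanged. *)
have avg : #|L|%:R * K = \sum_v psi v * \sum_z eta (f v).[z].
  under [RHS]eq_bigr => v _ do rewrite mulr_sumr.
  rewrite exchange_big /= mulr_natl -sumr_const; apply: eq_bigr => z _.
  rewrite /K (reindex_inj (addIr (z ^+ q - z))) /=; apply: eq_bigr => v _.
  rewrite shift /f /G !hornerE ?hornerXn; congr (_ * eta (_ ^+ 2 - _)).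
  exact: etrans (esym (addrA _ _ _)) (esym (sh z v)).
suff : #|L|%:R * `|K| <= #|L|%:R * ((4 * q + 3) * s)%:R by rewrite ler_pM2l.
rewrite -[X in X * `|_|](ger0_norm (ltW Q0)) -normrM avg.
apply: (le_trans (ler_norm_sum _ _ _)); rewrite mulr_natl -sumr_const.
by apply: ler_sum => v _; rewrite normrM add_char_norm // mul1r.
Qed.

(* An excess [delta] of [|K|^2 / q] over [4] is at least quadrupled by each
   quadratic extension, since [|2 q - K ^ 2| >= |K|^2 - 2 q]. *)
Lemma kloosterman_tower (F : finFieldType) (psi : F -> algC) (a b : F) (delta : algC) (m : nat) :
  odd #|F| -> add_char psi -> a != 0 -> b != 0 -> 0 <= delta ->
  (4%:R + delta) * #|F|%:R <= `|kloosterman psi a b| ^+ 2 ->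
  exists (L : finFieldType) (psiL : L -> algC) (x y : L),
    [/\ add_char psiL, #|L| = (#|F| ^ (2 ^ m))%N, [pchar L].-nat #|F|,
       (forall z, psiL (z ^+ #|F|) = psiL z) &
       [/\ x != 0, y != 0 & (4%:R + 4%:R ^+ m * delta) * #|L|%:R <= `|kloosterman psiL x y| ^+ 2]].
Proof.
move=> oF psiP a0 b0 d0 h; elim: m => [|m].
  exists F, psi, a, b; split=> //; first exact: pchar_nat_card.
    by move=> z; rewrite expf_card.
  by split; rewrite // mul1r.
case=> [L [psiL [x [y [psiLP cL pL inv [x0 y0 hK]]]]]].
have oL : odd #|L| by rewrite cL oddX oF orbT.
have [L' [psi' [iota [psi'P cL' hK' hinv]]]] := quad_ext oL psiLP.
exists L', psi', (iota x), (iota y); split=> //.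
- by rewrite cL' cL -expnM expnSr.
- by rewrite (eq_pnat _ (fmorph_pchar iota)).
- exact: hinv.
split; rewrite ?fmorph_eq0 // hK' // cL' natrX.
set Q : algC := #|L|%:R in hK *; set K := kloosterman _ _ _ in hK *.
have Q0 : 0 <= Q by rewrite ler0n.
set D := 4%:R ^+ m * delta in hK *.
have D0 : 0 <= D by rewrite mulr_ge0 // exprn_ge0.
have h1 : (2%:R + D) * Q <= `|2%:R * Q - K ^+ 2|.
  rewrite distrC; apply: le_trans (lerB_dist _ _).
  rewrite normrX normrM (ger0_norm Q0) normr_nat lerBrDr; apply: le_trans hK.
  by rewrite -mulrDl addrAC -natrD.
have h2 : 0 <= (2%:R + D) * Q by rewrite mulr_ge0 // addr_ge0.
(* [(2 + D)^2 >= 4 + 4 D], so squaring quadruples the excess. *)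
apply: le_trans (lerXn2r 2 _ _ h1); rewrite ?nnegrE //.
rewrite exprMn ler_wpM2r ?exprn_ge0 // exprS -mulrA -/D sqrrD -subr_ge0.
rewrite (_ : _ - _ = D ^+ 2) ?exprn_ge0 //; ring.
Qed.

(** An excess [delta] would grow to at least [4^m delta] at level [m] of the tower, while Stepanov's
    method caps [|K|^2 / |L|] at [(4 q + 3)^2] independently of the level. *)
Theorem kloosterman_weil (F : finFieldType) (psi : F -> algC) (a b : F) :
  odd #|F| -> add_char psi -> a != 0 -> b != 0 ->
  `|kloosterman psi a b| ^+ 2 <= 4%:R * #|F|%:R.
Proof.
move=> oF psiP a0 b0; set K := kloosterman _ _ _.
have q0 : 0 < #|F|%:R :> algC by rewrite ltr0n ltnW ?finNzRing_gt1.
rewrite real_leNgt ?rpredM ?rpredX ?realn ?normr_real //; apply/negP => hlt.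
pose delta := `|K| ^+ 2 / #|F|%:R - 4%:R.
have d0 : 0 < delta by rewrite subr_gt0 ltr_pdivlMr.
have hd : (4%:R + delta) * #|F|%:R <= `|K| ^+ 2.
  by rewrite addrC subrK divfK ?gt_eqF.
pose B : algC := ((4 * #|F| + 3) ^ 2)%:R.
(* [M] exceeds [B / delta]. The two extra levels used below make [s], the square root of [|L|], at
   least [q^2], whence [q <= s./2]. *)
pose M := Num.bound (B / delta).
have [L [psiL [x [y [psiLP cL pL inv [x0 y0 hK]]]]]] :=
  kloosterman_tower M.+2 oF psiP a0 b0 (ltW d0) hd.
pose s := (#|F| ^ (2 ^ M.+1))%N.
have sE : s = (s./2).*2.+1 by rewrite -[LHS]odd_double_half /s oddX oF orbT.
have F3 : (2 < #|F|)%N by have := finNzRing_gt1 F; move: oF; case: #|F| => [|[|[]]].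
have qa : (1 < #|F| <= s./2)%N.
  rewrite ltnW //=; have : (#|F| ^ 2 <= s)%N.
    by rewrite leq_exp2l ?(ltnW F3) // -{1}(expn1 2) leq_exp2l.
  move: sE F3; move: s #|F| => t n tE n3 h; move: tE h; move: (t./2) => u; clear -n3; nia.
have cLs : #|L| = (s ^ 2)%N by rewrite cL /s -expnM -expnSr.
have hs : [pchar L].-nat s by rewrite /s pnatX pL.
have := kloosterman_stepanov psiLP hs pL qa sE cLs inv x0 y0.
set KL := kloosterman _ _ _ in hK * => hKL.
have : `|KL| ^+ 2 <= B * #|L|%:R.
  by apply: le_trans (lerXn2r 2 _ _ hKL) _; rewrite ?nnegrE ?ler0n // -natrX expnMn cLs natrM.
have s0 : (0 < s)%N by rewrite expn_gt0 (ltnW (ltnW F3)).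
move=> /(le_trans hK); rewrite ler_pM2r ?ltr0n ?cLs ?sqrn_gt0 //.
apply/negP; rewrite -real_ltNge ?realn //; last first.
  by rewrite rpredD ?realn // rpredM ?rpredX ?realn // gtr0_real.
have : B / delta < M%:R.
  by have := archi_boundP (divr_ge0 (ler0n _ _ : 0 <= B) (ltW d0)).
rewrite ltr_pdivrMr // => /lt_le_trans; apply.
apply: (@le_trans _ _ (4%:R ^+ M.+2 * delta)).
  rewrite ler_pM2r // -natrX ler_nat.
  rewrite (leq_trans (ltnW (ltn_expl M (isT : 1 < 4)%N))) // leq_exp2l //.
  by rewrite (leq_trans (leqnSn M)).
by rewrite lerDr ler0n.
Qed.

(** * Gauss and Salie sums *)

Definition gauss_sum (F : finFieldType) (psi : F -> algC) (s : F) : algC :=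
  \sum_z psi (s * z ^+ 2).

Definition salie (F : finFieldType) (psi : F -> algC) (a b : F) : algC :=
  \sum_(x | x != 0) eta x * psi (a * x + b / x).

Section Gauss.
Variables (F : finFieldType) (psi : F -> algC).
Hypotheses (oF : odd #|F|) (psiP : add_char psi).
Local Notation q := (#|F|%:R : algC).

Lemma gauss_sum_complete (s m : F) : s != 0 ->
  \sum_z psi (s * z ^+ 2 + m * z) = psi (- (m ^+ 2 / (4%:R * s))) * gauss_sum psi s.
Proof.
move=> s0; have n2 := two_neq0 oF.
have n4 : 4%:R != 0 :> F by rewrite (natrM _ 2 2) mulf_neq0.
rewrite /gauss_sum mulr_sumr (reindex_inj (addIr (- (m / (2%:R * s))))) /=.
apply: eq_bigr => z _; rewrite -add_charD //; congr psi; field.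
by rewrite n2 s0 n4.
Qed.

(** Counting square roots turns the sum into [\sum_v eta v * psi (s * v)], and rescaling [v] by [s]
    releases [eta s]. *)
Lemma gauss_sumE (s : F) : s != 0 -> gauss_sum psi s = eta s * gauss_sum psi 1.
Proof.
move=> s0.
have H (u : F) : u != 0 -> gauss_sum psi u = \sum_v eta v * psi (u * v).
  move=> u0; rewrite /gauss_sum (@sum_fibers _ _ (fun z => z ^+ 2) (fun v => psi (u * v)) predT).
  under eq_bigr do rewrite card_sqrt mulrDl mul1r.
  by rewrite big_split /= add_char_sum // (negbTE u0) muln0 add0r.
rewrite !H ?oner_eq0 // mulr_sumr [RHS](reindex_inj (mulfI s0)) /=.
apply: eq_bigr => v _; rewrite etaM // mul1r !mulrA -expr2 eta_neq0 //.
by rewrite mul1r.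
Qed.

(** In the double sum for the squared modulus put [z = u + y]; the sum over [y] then vanishes unless
    [u = 0]. *)
Lemma gauss_sum_norm (s : F) : s != 0 -> `|gauss_sum psi s| ^+ 2 = q.
Proof.
move=> s0; have n2 := two_neq0 oF.
rewrite normCK {2}/gauss_sum rmorph_sum /= mulr_sumr.
under eq_bigr => y _.
  rewrite -add_charN // /gauss_sum mulr_suml (reindex_inj (addIr y)) /=.
  under eq_bigr => u _.
    rewrite -add_charD // (_ : _ + _ = s * u ^+ 2 + 2%:R * s * u * y); last by ring.
    rewrite add_charD //.
    over.
  over.
rewrite exchange_big /= (bigD1 0) //= [X in _ + X]big1 ?addr0.
  rewrite -mulr_sumr add_char_sum // mulr0 eqxx muln1 expr0n mulr0 add_char0 //.
  by rewrite mul1r.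
move=> u u0; rewrite -mulr_sumr add_char_sum // !mulf_eq0 (negbTE n2) (negbTE s0).
by rewrite (negbTE u0) muln0 mulr0.
Qed.

(** Replacing [x] by [- b x] brings the second argument to the form [- c^2] that [gauss_salie]
    requires, with [c = 1]. *)
Lemma salie_scale (a b : F) : b != 0 ->
  salie psi a b = eta (- b) * salie psi (- (a * b)) (- 1).
Proof.
move=> b0; have nb0 : - b != 0 by rewrite oppr_eq0.
rewrite /salie mulr_sumr (reindex_inj (mulfI nb0)) /=.
apply: eq_big => x; first by rewrite mulf_eq0 (negbTE nb0).
rewrite mulf_eq0 (negbTE nb0) /= => x0.
rewrite etaM // -mulrA; congr (_ * (_ * psi _)); field.
by rewrite ?x0 ?b0.
Qed.

(* Completing the square in [eta x * gauss_sum psi 1 = \sum_y psi (x (y + c / x) ^ 2)]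
   cancels the term [- c ^ 2 / x]. *)
Lemma gauss_salie (a c : F) :
  gauss_sum psi 1 * salie psi a (- c ^+ 2) =
  \sum_y psi (2%:R * c * y) * (q * (y ^+ 2 == - a)%:R - 1).
Proof.
transitivity (\sum_(x | x != 0) \sum_y psi (2%:R * c * y) * psi ((y ^+ 2 + a) * x)).
  rewrite /salie mulr_sumr; apply: eq_bigr => x x0.
  rewrite mulrA [_ * eta x]mulrC -gauss_sumE // /gauss_sum mulr_suml.
  rewrite (reindex_inj (addIr (c / x))) /=; apply: eq_bigr => y _.
  by rewrite -!add_charD //; congr psi; field.
rewrite exchange_big /=; apply: eq_bigr => y _; rewrite -mulr_sumr; congr (_ * _).
have := add_char_sum psiP (y ^+ 2 + a); rewrite (bigD1 0) //= mulr0 add_char0 //.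
by rewrite addr_eq0 natrM => <-; rewrite addrC addrK.
Qed.

Lemma sum_sqrt_norm (a c : F) : a != 0 ->
  `|\sum_y psi (c * y) * (y ^+ 2 == a)%:R| <= 2%:R.
Proof.
move=> a0; apply: (le_trans (ler_norm_sum _ _ _)).
rewrite (eq_bigr (fun y : F => (y ^+ 2 == a)%:R)); last first.
  by move=> y _; rewrite normrM add_char_norm // mul1r normr_nat.
rewrite -natr_sum -big_mkcond sum1dep_card card_sqrt.
by have [[_ ->]|[_ _ ->]|[_ _ ->]] := etaP a oF; rewrite ?addr0 ?subrr ?ler0n ?ler1n.
Qed.

Lemma salie_bound (a b : F) : a != 0 -> `|salie psi a b| ^+ 2 <= 4%:R * q.
Proof.
move=> a0.
have q0 : 0 < q by rewrite ltr0n ltnW ?finNzRing_gt1.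
have gN := gauss_sum_norm (oner_neq0 F).
suff bnd a' c : a' != 0 -> (c == 0) || (c == 1) ->
    `|gauss_sum psi 1 * salie psi a' (- c ^+ 2)| <= 2%:R * q.
  have H a' c : a' != 0 -> (c == 0) || (c == 1) ->
      `|salie psi a' (- c ^+ 2)| ^+ 2 <= 4%:R * q.
    move=> a'0 c01; have := bnd a' c a'0 c01.
    move=> /(lerXn2r 2); rewrite !nnegrE normr_ge0 mulr_ge0 ?ler0n // => /(_ isT isT).
    rewrite normrM exprMn gN (_ : (2%:R * q) ^+ 2 = q * (4%:R * q)); last by ring.
    by rewrite ler_pM2l.
  have [b0|b0] := eqVneq b 0.
    by have := H a 0 a0; rewrite eqxx expr0n oppr0 b0; apply.
  rewrite salie_scale // normrM exprMn -normrX eta_neq0 ?oppr_eq0 // normr1 mul1r.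
  by have := H (- (a * b)) 1; rewrite eqxx orbT expr1n oppr_eq0 mulf_neq0 //; apply.
move=> a'0 c01; rewrite gauss_salie.
rewrite (eq_bigr (fun y => q * (psi (2%:R * c * y) * (y ^+ 2 == - a')%:R) -
   psi (2%:R * c * y))); last by move=> y _; rewrite mulrBr mulr1 mulrCA.
rewrite sumrB -mulr_sumr add_char_sum //.
(* For [c = 1] the last sum vanishes and at most two square roots of [- a'] remain; for [c = 0] it
   is [q] and cancels the [1] in [1 + eta (- a')]. *)
case/orP: c01 => /eqP ->; last first.
  rewrite mulr1 (negbTE (two_neq0 oF)) muln0 subr0 normrM normr_nat mulrC ler_pM2r //.
  by rewrite sum_sqrt_norm // oppr_eq0.
rewrite mulr0 eqxx muln1.
under eq_bigr do rewrite mul0r add_char0 // mul1r.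
rewrite -natr_sum -big_mkcond sum1dep_card card_sqrt mulrDr mulr1 addrAC subrr add0r.
rewrite normrM normr_nat mulrC ler_pM2r //.
by rewrite (le_trans (eta_norm_le1 _ oF)) // ler1n.
Qed.
End Gauss.

(** * Counting pairs at a given distance *)

Lemma sum_prod_rV (F : finFieldType) (d : nat) (g : 'I_d -> F -> algC) :
  \sum_(w : 'rV[F]_d) \prod_i g i (w 0 i) = \prod_i \sum_z g i z.
Proof.
rewrite bigA_distr_bigA /= (reindex (fun f : {ffun 'I_d -> F} => \row_i f i)) /=.
  by apply: eq_bigr => f _; apply: eq_bigr => i _; rewrite mxE.
exists (fun w : 'rV[F]_d => [ffun i => w 0 i]) => [f _|w _].
  by apply/ffunP => i; rewrite ffunE mxE.
by apply/rowP => i; rewrite mxE ffunE.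
Qed.

Section Distances.
Variables (F : finFieldType) (psi : F -> algC) (d : nat).
Hypotheses (oF : odd #|F|) (psiP : add_char psi).
Local Notation V := 'rV[F]_d.
Local Notation q := (#|F|%:R : algC).

Lemma add_char_bigsum (I : finType) (f : I -> F) : psi (\sum_i f i) = \prod_i psi (f i).
Proof. by apply: (big_morph psi (add_charD psiP) (add_char0 psiP)). Qed.

Let dot (m w : V) := \sum_i m 0 i * w 0 i.

Lemma dot_orthogonality (w : V) : \sum_m psi (dot m w) = (#|V| * (w == 0))%:R.
Proof.
under eq_bigr do rewrite /dot add_char_bigsum.
rewrite (@sum_prod_rV _ _ (fun i z => psi (z * w 0 i))).
under eq_bigr => i _.
  under eq_bigr do rewrite mulrC.
  rewrite add_char_sum //.
  over.
have [->|w0] := eqVneq w 0.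
  under eq_bigr do rewrite mxE eqxx muln1.
  by rewrite prodr_const card_ord -natrX card_mx mul1n muln1.
rewrite muln0; have /rV0Pn[i wi] := w0.
by rewrite (bigD1 i) //= (negbTE wi) muln0 mul0r.
Qed.

Lemma dotBr (m x y : V) : dot m (x - y) = dot m x - dot m y.
Proof. by rewrite -sumrB; apply: eq_bigr => i _; rewrite !mxE mulrBr. Qed.

(* Plancherel, applied to a convolution operator with kernel [k]. *)
Lemma convolution_bound (k : V -> algC) (E : {set V}) (B : algC) :
  (forall m, `|\sum_w k w * psi (dot m w)| <= B) ->
  `|\sum_(x in E) \sum_(y in E) k (x - y)| <= B * #|E|%:R.
Proof.
move=> hB; pose kh m := \sum_w k w * psi (dot m w).
pose Eh m := \sum_(x in E) psi (- dot m x).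
have N0 : 0 < #|V|%:R :> algC by rewrite ltr0n; apply/card_gt0P; exists 0.
have inversion z : #|V|%:R * k z = \sum_m kh m * psi (- dot m z).
  under [RHS]eq_bigr do rewrite mulr_suml.
  rewrite exchange_big /= (bigD1 z) //= [X in _ + X]big1 ?addr0.
    under eq_bigr do rewrite -mulrA -add_charD // subrr add_char0 // mulr1.
    by rewrite sumr_const mulr_natl.
  move=> w wz; under eq_bigr do rewrite -mulrA -add_charD // -dotBr.
  by rewrite -mulr_sumr dot_orthogonality subr_eq0 (negbTE wz) muln0 mulr0.
have conv : #|V|%:R * (\sum_(x in E) \sum_(y in E) k (x - y)) = \sum_m kh m * `|Eh m| ^+ 2.
  rewrite mulr_sumr; under eq_bigr => x _.
    rewrite mulr_sumr; under eq_bigr do rewrite inversion.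
    rewrite exchange_big /=; over.
  rewrite exchange_big /=; apply: eq_bigr => m _.
  move: (kh m) => c; rewrite normCK /Eh rmorph_sum /= mulr_suml mulr_sumr; apply: eq_bigr => x _.
  rewrite mulr_sumr mulr_sumr; apply: eq_bigr => y _.
  by rewrite dotBr opprB addrC add_charD // -(add_charN psiP (- dot m y)) opprK.
have plancherel : \sum_m `|Eh m| ^+ 2 = #|V|%:R * #|E|%:R.
  have sqE m : `|Eh m| ^+ 2 = \sum_(x in E) \sum_(y in E) psi (dot m (y - x)).
    rewrite normCK /Eh rmorph_sum /= mulr_suml; apply: eq_bigr => x _.
    rewrite mulr_sumr; apply: eq_bigr => y _.
    by rewrite -add_charN // opprK -add_charD // addrC -dotBr.
  under eq_bigr do rewrite sqE.
  rewrite exchange_big /= [_ * #|E|%:R]mulr_natr -sumr_const; apply: eq_bigr => x xE.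
  rewrite exchange_big /= (bigD1 x) //= [X in _ + X]big1 ?addr0.
    by rewrite dot_orthogonality subrr eqxx muln1.
  by move=> y /andP[_ yx]; rewrite dot_orthogonality subr_eq0 (negbTE yx) muln0.
suff : #|V|%:R * `|\sum_(x in E) \sum_(y in E) k (x - y)| <= #|V|%:R * (B * #|E|%:R).
  by rewrite (ler_pM2l N0).
rewrite -[X in X * `|_| <= _](ger0_norm (ltW N0)) -normrM conv.
apply: (le_trans (ler_norm_sum _ _ _)).
rewrite mulrCA -plancherel mulr_sumr; apply: ler_sum => m _.
rewrite normrM normrX normr_id ler_wpM2r ?exprn_ge0 //; exact: hB.
Qed.

(** By orthogonality this is [q] times the indicator of [qnorm z = t], minus [1]; the omitted term
    [s = 0] accounts for the main term [|E|^2]. *)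
Let sphere_kernel t (z : V) := \sum_(s | s != 0) psi (s * (qnorm z - t)).

(** The sum over [w] factors into [d] quadratic Gauss sums. What remains is a sum over [s] weighted
    by [eta s ^ d], of Salie type for [d] odd and of Kloosterman type for [d] even. *)
Lemma sphere_kernel_hat t m : t != 0 ->
  `|\sum_w sphere_kernel t w * psi (dot m w)| ^+ 2 <= 4%:R * q ^+ d.+1.
Proof.
move=> t0; have n2 := two_neq0 oF.
have n4 : 4%:R != 0 :> F by rewrite (natrM _ 2 2) mulf_neq0.
have q1 : 1 <= q by rewrite ler1n ltnW ?finNzRing_gt1.
pose b := - (qnorm m / 4%:R).
have -> : \sum_w sphere_kernel t w * psi (dot m w) =
    gauss_sum psi 1 ^+ d * \sum_(s | s != 0) eta s ^+ d * psi (- t * s + b / s).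
  under eq_bigr do rewrite /sphere_kernel mulr_suml.
  rewrite exchange_big /= mulr_sumr; apply: eq_bigr => s s0.
  transitivity (psi (- t * s) * \sum_w \prod_i psi (s * (w : V) 0 i ^+ 2 + m 0 i * w 0 i)).
    rewrite mulr_sumr; apply: eq_bigr => w _.
    rewrite -add_char_bigsum -!add_charD //; congr psi.
    by rewrite big_split /= -mulr_sumr /dot /qnorm; ring.
  rewrite (@sum_prod_rV _ _ (fun i z => psi (s * z ^+ 2 + m 0 i * z))).
  under eq_bigr do rewrite gauss_sum_complete // gauss_sumE //.
  rewrite big_split /= -add_char_bigsum prodr_const card_ord exprMn.
  have -> : \sum_i - (m 0 i ^+ 2 / (4%:R * s)) = b / s.
    rewrite /b /qnorm sumrN mulNr; congr (- _); rewrite !mulr_suml.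
    by apply: eq_bigr => i _; field; rewrite s0 n4.
  by rewrite add_charD //; ring.
rewrite normrM exprMn normrX -exprM mulnC exprM gauss_sum_norm ?oner_eq0 //.
rewrite (_ : 4%:R * q ^+ d.+1 = q ^+ d * (4%:R * q)); last by rewrite exprS; ring.
rewrite ler_wpM2l ?exprn_ge0 ?ler0n //.
have nt0 : - t != 0 by rewrite oppr_eq0.
have [od|ed] := boolP (odd d).
  rewrite (eq_bigr (fun s => eta s * psi (- t * s + b / s))); first exact: salie_bound.
  move=> s s0; rewrite -[in eta s ^+ d](odd_double_half d) od exprD expr1 -mul2n exprM eta_neq0 //.
  by rewrite expr1n mulr1.
rewrite (eq_bigr (fun s => psi (- t * s + b / s))); last first.
  move=> s s0; rewrite -[in eta s ^+ d](odd_double_half d) (negbTE ed) -mul2n exprM eta_neq0 //.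
  by rewrite expr1n mul1r.
(* Weil's bound requires [b != 0]; for [b = 0] the sum is [-1], because [t != 0]. *)
have [->|b0] := eqVneq b 0; last exact: kloosterman_weil.
under eq_bigr do rewrite mul0r addr0.
have := add_char_sum psiP (- t); rewrite (negbTE nt0) muln0 (bigD1 0) //= mulr0 add_char0 //.
move/eqP; rewrite addrC addr_eq0 => /eqP ->; rewrite normrN normr1 expr1n.
by rewrite (le_trans q1) // -[leLHS]mul1r ler_wpM2r ?ler0n // ler1n.
Qed.

(* The Iosevich--Rudnev bound. *)
Lemma distance_pairs_bound (t : F) (E : {set V}) : t != 0 ->
  `|(#|F| * #|[set p in setX E E | qnorm (p.1 - p.2) == t]|)%:R - (#|E| ^ 2)%:R : algC| <=
  2%:R * sqrtC q ^+ d.+1 * #|E|%:R.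
Proof.
move=> t0; set nu := #|_|.
have -> : (#|F| * nu)%:R - (#|E| ^ 2)%:R = \sum_(x in E) \sum_(y in E) sphere_kernel t (x - y).
  rewrite pair_big_dep /=; apply/eqP; rewrite subr_eq; apply/eqP.
  have -> : (#|E| ^ 2)%:R = \sum_(p : V * V | (p.1 \in E) && (p.2 \in E)) 1 :> algC.
    rewrite -mulnn -cardsX -sum1_card natr_sum; apply: eq_bigl => p.
    by rewrite inE.
  rewrite -big_split /= /nu -sum1dep_card natrM natr_sum mulr_sumr.
  rewrite (eq_bigl (fun p => ((p.1 \in E) && (p.2 \in E)) && (qnorm (p.1 - p.2) == t))); last first.
    by move=> p; rewrite !inE.
  rewrite big_mkcondr; apply: eq_bigr => p _.
  have := add_char_sum psiP (qnorm (p.1 - p.2) - t); rewrite (bigD1 0) //= mulr0 add_char0 //.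
  rewrite subr_eq0 addrC /sphere_kernel.
  under [X in X + _ = _]eq_bigr do rewrite mulrC.
  by move=> ->; case: eqP; rewrite ?muln1 ?muln0 ?mulr1.
apply: convolution_bound => m.
rewrite -(@ler_pXn2r _ 2) ?nnegrE ?mulr_ge0 ?exprn_ge0 ?sqrtC_ge0 ?ler0n //.
rewrite exprMn -exprM mulnC exprM sqrtCK; apply: (le_trans (sphere_kernel_hat m t0)).
by rewrite (_ : 2%:R ^+ 2 = 4%:R :> algC) //; ring.
Qed.

(** The size hypothesis says [4 q^((d+1)/2) <= |E|], which makes the error at most half of the main
    term. *)
Lemma distance_pairs_ge (t : F) (E : {set V}) : t != 0 ->
  (16 * #|F| ^ d.+1 <= #|E| ^ 2)%N ->
  (#|E| ^ 2 <= 2 * #|F| * #|[set p in setX E E | qnorm (p.1 - p.2) == t]|)%N.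
Proof.
move=> t0 hE; have := distance_pairs_bound E t0; set nu := #|[set _ in _ | _]|.
set X : algC := _%:R - _; set w := sqrtC q ^+ d.+1; set n := #|E| => hX.
have w0 : 0 <= w by rewrite exprn_ge0 // sqrtC_ge0 ler0n.
have hw : 4%:R * w <= n%:R.
  rewrite -(@ler_pXn2r _ 2) ?nnegrE ?mulr_ge0 ?ler0n //.
  by rewrite exprMn -exprM mulnC exprM sqrtCK -!natrX -natrM ler_nat.
have hX2 : 2%:R * `|X| <= (n ^ 2)%:R.
  apply: (@le_trans _ _ (4%:R * w * n%:R)).
    rewrite (_ : 4%:R * w * n%:R = 2%:R * (2%:R * w * n%:R)); last by ring.
    by rewrite ler_wpM2l.
  by rewrite natrX expr2 ler_wpM2r ?ler0n.
have rX : X \is Num.real by rewrite rpredB ?realn.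
have : - X <= `|X| by rewrite -normrN real_ler_norm ?rpredN.
move=> /(ler_wpM2l (ler0n _ 2)) /le_trans /(_ hX2).
rewrite /X mulrN mulrBr opprB lerBlDr -!natrM -natrD ler_nat; lia.
Qed.
End Distances.

(** * Embedding bipartite graphs *)

(** Convexity: the power function lies above its tangent at [m]. *)
Lemma tangent_pow (R : realDomainType) (x m : R) (k : nat) : 0 <= x -> 0 <= m ->
  k.+1%:R * m ^+ k * x <= x ^+ k.+1 + k%:R * m ^+ k.+1.
Proof.
move=> x0 m0; elim: k => [|k IH]; first by rewrite mul0r addr0 !mulr1 !mul1r.
rewrite -subr_ge0.
rewrite (_ : _ - _ = x * (x ^+ k.+1 + k%:R * m ^+ k.+1 - k.+1%:R * m ^+ k * x) +
   k.+1%:R * m ^+ k * (x - m) ^+ 2).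
  apply: addr_ge0; first by rewrite mulr_ge0 ?subr_ge0.
  by rewrite mulr_ge0 ?sqr_ge0 // mulr_ge0 ?exprn_ge0 ?ler0n.
by rewrite !exprS -[k.+2]addn1 -[k.+1]addn1 !natrD; ring.
Qed.

(** Sum the tangent inequality over [x = n a_i] at [m = S]; the scaling by [n] avoids the fractional
    mean [S / n]. *)
Lemma power_mean_nat (I : finType) (E : {set I}) (a : I -> nat) (r : nat) :
  (0 < r)%N ->
  (#|E| * (\sum_(i in E) a i) ^ r <= #|E| ^ r * \sum_(i in E) a i ^ r)%N.
Proof.
case: r => // k _; set S := (\sum_(i in E) a i)%N; set n := #|E|.
have H i : (k.+1 * S ^ k * (n * a i) <= (n * a i) ^ k.+1 + k * S ^ k.+1)%N.
  have := @tangent_pow int (n * a i)%:R S%:R k (ler0n _ _) (ler0n _ _).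
  by rewrite -!natrX -!natrM -natrD ler_nat.
have h : (\sum_(i in E) k.+1 * S ^ k * (n * a i) <=
    \sum_(i in E) ((n * a i) ^ k.+1 + k * S ^ k.+1))%N by apply: leq_sum => i _; apply: H.
move: h; rewrite big_split /= sum_nat_const -/n -!big_distrr /= -/S.
have -> : (\sum_(i in E) (n * a i) ^ k.+1 = n ^ k.+1 * \sum_(i in E) a i ^ k.+1)%N.
  by rewrite big_distrr /=; apply: eq_bigr => i _; rewrite expnMn.
have -> : (k.+1 * S ^ k * (n * S) = n * S ^ k.+1 + n * (k * S ^ k.+1))%N.
  by rewrite expnS; ring.
by rewrite leq_add2r.
Qed.

Section DependentRandomChoice.
Variables (V : finType) (e : rel V) (E : {set V}) (r : nat).
Hypothesis e_sym : symmetric e.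
Hypothesis r0 : (0 < r)%N.

(** Tuples may repeat entries, so that a neighbour list shorter than [r] can be padded. *)
Definition common_nbrs (f : {ffun 'I_r -> V}) : {set V} :=
  [set v in E | [forall i, e (f i) v]].

(** Double counting: [v] is a common neighbour of [f] exactly when all entries of [f] are neighbours
    of [v]. *)
Lemma sum_common_nbrs :
  (\sum_(f in ffun_on (mem E)) #|common_nbrs f| =
   \sum_(v in E) #|[set u in E | e u v]| ^ r)%N.
Proof.
under eq_bigr do rewrite -sum1_card.
rewrite (exchange_big_dep (mem E)) /=; last by move=> f v _; rewrite inE => /andP[].
apply: eq_bigr => v vE.
rewrite -[r in RHS]card_ord -card_ffun_on sum1dep_card; apply: eq_card => f.
rewrite inE; apply/andP/ffun_onP => [[/ffun_onP fE]|h].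
  by rewrite inE => /andP[_ /forallP h] i; rewrite inE fE h.
split; first by apply/ffun_onP => i; have := h i; rewrite inE => /andP[].
by rewrite inE vE; apply/forallP => i; have := h i; rewrite inE => /andP[].
Qed.

(** Double counting: if [t] lies in the common neighbourhood of [f], then [f] lies in that of [t],
    which leaves at most [h ^ r] choices of [f] for a bad [t]. *)
Lemma sum_bad_tuples (h : nat) :
  (\sum_(f in ffun_on (mem E)) #|[set t in ffun_on (mem (common_nbrs f)) |
      (#|common_nbrs t| < h)%N]| <= #|E| ^ r * h ^ r)%N.
Proof.
under eq_bigr do rewrite -sum1dep_card.
rewrite (exchange_big_dep
  (fun t => (t \in ffun_on (mem E)) && (#|common_nbrs t| < h)%N)) /=; last first.
  move=> f t _ /andP[/ffun_onP ht ->]; rewrite andbT; apply/ffun_onP => i.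
  by have := ht i; rewrite inE => /andP[].
apply: (@leq_trans (\sum_(t in ffun_on (mem E)) h ^ r)%N).
  rewrite big_mkcondr /=; apply: leq_sum => t /ffun_onP tE; case: ifP => // th.
  rewrite sum1dep_card; apply: (@leq_trans (#|common_nbrs t| ^ #|'I_r|)%N); last first.
    by rewrite card_ord leq_exp2r // ltnW.
  rewrite -card_ffun_on; apply: subset_leq_card; apply/subsetP => f.
  rewrite inE => /andP[/ffun_onP fE /andP[/ffun_onP ht _]]; apply/ffun_onP => i.
  rewrite inE fE; apply/forallP => j; have := ht j.
  by rewrite inE => /andP[_ /forallP /(_ i)]; rewrite e_sym.
by rewrite sum_nat_const card_ffun_on card_ord.
Qed.

(* Some tuple [f] has more common neighbours than bad tuples among them; deleting
   the first entry of every bad tuple leaves [A]. *)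
Lemma dependent_random_choice (q h : nat) : (0 < q)%N -> (0 < h)%N ->
  (#|E| ^ 2 <= 2 * q * #|[set p in setX E E | e p.1 p.2]|)%N ->
  ((2 * q) ^ r * (h ^ r + h) <= #|E|)%N ->
  exists A : {set V}, [/\ A \subset E, (h <= #|A|)%N &
    forall t : {ffun 'I_r -> V}, (forall i, t i \in A) -> (h <= #|common_nbrs t|)%N].
Proof.
move=> q0 h0 hnu hn; set n := #|E| in hnu hn; set nu := #|_| in hnu.
pose bad f := [set t in ffun_on (mem (common_nbrs f)) | (#|common_nbrs t| < h)%N].
have n0 : (0 < n)%N.
  by apply: leq_trans hn; rewrite muln_gt0 expn_gt0 muln_gt0 q0 addn_gt0 h0 orbT.
have nuE : nu = (\sum_(v in E) #|[set u in E | e u v]|)%N.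
  rewrite /nu; under [RHS]eq_bigr do rewrite -sum1dep_card.
  rewrite pair_big_dep /= sum1dep_card.
  by apply: eq_card => -[v u]; rewrite !inE /= e_sym andbA.
have [f fP] : exists f : {ffun 'I_r -> V}, (#|bad f| + h <= #|common_nbrs f|)%N.
  have [/existsP //|/existsPn no] :=
    boolP [exists f : {ffun 'I_r -> V}, #|bad f| + h <= #|common_nbrs f|]%N.
  exfalso.
  have cf : #|[pred f : {ffun 'I_r -> V} | f \in ffun_on (mem E)]| = (n ^ r)%N.
    by rewrite card_ffun_on card_ord.
  (* If no [f] works, then [|common_nbrs f| + 1 <= |bad f| + h] for all [f]; this is summed over the
     tuples in [E]. *)
  have lt1 : (\sum_(v in E) #|[set u in E | e u v]| ^ r + n ^ r <= n ^ r * h ^ r + n ^ r * h)%N.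
    rewrite -sum_common_nbrs -{1}cf -sum1_card -big_split /=.
    apply: (@leq_trans (\sum_(f in ffun_on (mem E)) (#|bad f| + h))%N).
      by apply: leq_sum => f _; have := no f; rewrite -ltnNge addn1.
    rewrite big_split /= sum_nat_const card_ffun_on card_ord -/n leq_add2r.
    exact: sum_bad_tuples.
  (* With [n^2 <= 2 q nu], the power mean inequality gives [n^(r+1) <= (2 q)^r D], which contradicts
     [lt1] and [hn]. *)
  have := power_mean_nat E (fun v => #|[set u in E | e u v]|) r0.
  rewrite -nuE -/n; move: lt1; set D := (\sum_(v in E) _ ^ r)%N => lt1 pm.
  have nr0 : (0 < n ^ r)%N by rewrite expn_gt0 n0.
  have h1 : (n * (n ^ r * n ^ r) <= n ^ r * ((2 * q) ^ r * D))%N.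
    apply: (@leq_trans (n * ((2 * q) ^ r * nu ^ r))).
      by rewrite leq_mul2l -!expnMn leq_exp2r // mulnn hnu orbT.
    by rewrite mulnCA [leqRHS]mulnCA leq_mul2l pm orbT.
  move: h1; rewrite mulnCA leq_pmul2l // => h1.
  have q2 : (0 < (2 * q) ^ r)%N by rewrite expn_gt0 muln_gt0 q0.
  move: (n ^ r)%N ((2 * q) ^ r)%N (h ^ r)%N nr0 h1 hn lt1 q2 => N Q H nr0 h1 hn lt1 q2.
  have : (Q * D < n * N)%N.
    apply: (@leq_trans (Q * (N * (H + h)))); last first.
      by rewrite mulnA [(Q * N)%N]mulnC -mulnA [leqRHS]mulnC leq_mul2l hn orbT.
    by rewrite ltn_pmul2l // mulnDr; apply: leq_trans lt1; rewrite -addn1 leq_add2l.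
  by rewrite ltnNge h1.
pose i0 : 'I_r := Ordinal r0.
exists (common_nbrs f :\: [set (t : {ffun 'I_r -> V}) i0 | t in bad f]); split.
- by apply/subsetP => v; rewrite !inE => /and3P[].
- rewrite cardsD leq_subRL; last by apply: subset_leq_card; apply: subsetIl.
  apply: leq_trans fP; rewrite leq_add2r; apply: (leq_trans (subset_leq_card (subsetIr _ _))).
  exact: leq_imset_card.
move=> t tA; rewrite leqNgt; apply/negP => th.
have := tA i0; rewrite inE => /andP[/imsetP + _]; apply; exists t => //.
rewrite inE th andbT; apply/ffun_onP => i.
by have := tA i; rewrite inE => /andP[].
Qed.
End DependentRandomChoice.

(** Values are chosen one at a time, each joining the forbidden set [B], so [|B| + size s] does not
    grow. *)
Lemma greedy_injection (T V : finType) (v0 : V) (N : T -> {set V}) (s : seq T) (B : {set V}) :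
  uniq s -> (forall x, x \in s -> (#|B| + size s <= #|N x|)%N) ->
  exists g : T -> V, {in s &, injective g} /\
    forall x, x \in s -> g x \in N x /\ g x \notin B.
Proof.
elim: s B => [|x s IH] B; first by move=> _ _; exists (fun=> v0).
move=> /= /andP[xs us] hN.
have [w wN wB] : exists2 w, w \in N x & w \notin B.
  apply/subsetPn; apply/negP => /subset_leq_card.
  by have := hN x (mem_head _ _); lia.
have [y ys|g [ginj gP]] := IH (w |: B) us.
  by have := hN y; rewrite inE ys orbT cardsU1 wB => /(_ isT); lia.
have gx y : y \in s -> (y == x) = false by move=> ys; apply: contraNF xs => /eqP <-.
exists (fun y => if y == x then w else g y); split=> [y z|y]; rewrite !inE.
  case/orP=> [/eqP->|ys]; case/orP=> [/eqP->|zs] //; rewrite ?eqxx ?gx //.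
  - by move=> wg; have [_] := gP z zs; rewrite -wg !inE eqxx.
  - by move=> gw; have [_] := gP y ys; rewrite gw !inE eqxx.
  exact: ginj.
case/orP=> [/eqP->|ys]; first by rewrite eqxx.
by rewrite gx //; have [gN] := gP y ys; rewrite !inE negb_or => /andP[_].
Qed.

(** [Y] is placed injectively in [A]. Each vertex of [X] then has more than [|T|] admissible images,
    and these are chosen greedily, distinct and off the image of [Y]; at most [|X| + |Y| <= |T|]
    candidates are ever excluded. *)
Lemma bipartite_embedding (T V : finType) (G : sgraph T) (X Y : {set T})
    (e : rel V) (E A : {set V}) (r : nat) :
  bipartite_parts G X Y -> {in X, forall v, deg G v <= r}%N -> symmetric e ->
  A \subset E -> (#|T| < #|A|)%N ->
  (forall t : {ffun 'I_r -> V}, (forall i, t i \in A) -> (#|T| < #|common_nbrs e E t|)%N) ->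
  exists f : T -> V, [/\ {in vset G &, injective f},
    {in vset G, forall v, f v \in E} & forall x y, adj G x y -> e (f x) (f y)].
Proof.
move=> [XY dXY iX iY] dX e_sym AE cA good.
have [a0 a0A] : exists a, a \in A by apply/card_gt0P; apply: leq_trans cA.
pose f0 (v : T) := nth a0 (enum A) (index v (enum T)).
have lt0 v : (index v (enum T) < size (enum A))%N.
  by rewrite -cardE; apply: leq_trans cA; rewrite ltnW // ltnS cardE index_mem mem_enum.
have f0A v : f0 v \in A by rewrite -mem_enum mem_nth.
have f0inj : injective f0.
  move=> u v /eqP; rewrite nth_uniq ?enum_uniq // => /eqP.
  by move/(congr1 (nth u (enum T))); rewrite !nth_index ?mem_enum.
(* Positions beyond the degree of [v] take the default [f0 v], which also lies in [A]. *)
pose t v := [ffun i : 'I_r => f0 (nth v (enum (adj G v)) i)].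
pose N v := common_nbrs e E (t v).
have [||g [ginj gP]] := @greedy_injection T V a0 N (enum X) (f0 @: Y).
- exact: enum_uniq.
- move=> v _; apply: ltnW; apply: leq_ltn_trans (good (t v) _); last by move=> i; rewrite ffunE.
  rewrite card_imset // -cardE addnC -cardsUI (_ : X :&: Y = set0) ?cards0 ?addn0 ?max_card //.
  by apply/eqP; rewrite setI_eq0.
have gPX x : x \in X -> g x \in N x /\ g x \notin f0 @: Y by rewrite -mem_enum; apply: gP.
have inj0 x y : x \in X -> y \in Y -> g x <> f0 y.
  move=> xX yY gf; have [_] := gPX x xX.
  by rewrite gf imset_f.
exists (fun v => if v \in X then g v else f0 v); split.
- move=> x y; rewrite -XY !inE; case: ifP => xX /=; case: ifP => yX //= xY yY.
  + by apply: ginj; rewrite mem_enum.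
  + by move/inj0 => /(_ xX yY).
  + by move/esym/inj0 => /(_ yX xY).
  by move/f0inj.
- move=> v; rewrite -XY !inE; case: ifP => [vX _|_ vY].
    by have [+ _] := gPX v vX; rewrite inE => /andP[].
  by rewrite (subsetP AE).
have key x y : x \in X -> adj G x y -> e (g x) (f0 y).
  move=> xX xy; have [+ _] := gPX x xX; rewrite inE => /andP[_ /forallP h].
  have yN : y \in enum (adj G x) by rewrite mem_enum.
  have lti : (index y (enum (adj G x)) < r)%N.
    by apply: leq_trans (dX x xX); rewrite /deg cardE index_mem.
  by have := h (Ordinal lti); rewrite ffunE /= nth_index // e_sym.
move=> x y xy; have xv := adj_vset xy.
have yv : y \in vset G by apply: (@adj_vset _ G y x); rewrite adj_sym.
move: xv yv; rewrite -XY !inE; case: ifP => xX; case: ifP => yX //= xY yY.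
- by have := iX x y xX yX; rewrite xy.
- exact: key.
- by rewrite e_sym; apply: key; rewrite // adj_sym.
by have := iY x y xY yY; rewrite xy.
Qed.

(** The subgraph is the image of [G] with only the images of edges, since the distance graph may
    have further edges on [f @: vset G]. *)
Lemma embedding_graph_dist_set (T : finType) (G : sgraph T) (F : finFieldType)
    (d : nat) (t : F) (E : {set 'rV[F]_d}) (f : T -> 'rV[F]_d) :
  {in vset G &, injective f} -> {in vset G, forall v, f v \in E} ->
  (forall x y, adj G x y -> qnorm (f x - f y) = t) -> graph_dist_set G E t.
Proof.
move=> finj fE ft.
pose aH : rel 'rV[F]_d := fun u v =>
  [exists x, exists y, [&& adj G x y, f x == u & f y == v]].
have aHP u v : reflect (exists x y, [/\ adj G x y, f x = u & f y = v]) (aH u v).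
  apply: (iffP existsP) => [[x /existsP[y /and3P[xy /eqP fx /eqP fy]]]|[x [y [xy fx fy]]]].
    by exists x, y.
  by exists x; apply/existsP; exists y; rewrite xy fx fy !eqxx.
have adjr x y : adj G x y -> y \in vset G.
  by rewrite adj_sym; apply: adj_vset.
have aHv u v : aH u v -> u \in f @: vset G.
  by move=> /aHP[x [y [/adj_vset xG <- _]]]; rewrite imset_f.
have aHs : symmetric aH.
  suff H u v : aH u v -> aH v u by move=> u v; apply/idP/idP; apply: H.
  by move=> /aHP[x [y [xy fx fy]]]; apply/aHP; exists y, x; rewrite adj_sym.
have neq x y : adj G x y -> f x != f y.
  move=> xy; apply/eqP => /finj fxy; move: (xy).
  by rewrite fxy ?(adj_vset xy) ?(adjr _ _ xy) // adj_irrefl.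
have aHi : irreflexive aH.
  move=> u; case: (aHP u u) => // -[x [y [xy fx fy]]].
  by have := neq x y xy; rewrite fx fy eqxx.
exists (SGraph aHv aHs aHi); split.
  split=> /=; first by apply/subsetP => _ /imsetP[x xG ->]; apply: fE.
  move=> u v /aHP[x [y [xy <- <-]]]; apply/and4P; split.
  - exact: fE (adj_vset xy).
  - exact: fE (adjr _ _ xy).
  - exact: neq.
  by rewrite ft.
exists f; split=> //= x y xG yG; apply/idP/idP => [/aHP[x' [y' [xy fx fy]]]|xy]; last first.
  by apply/aHP; exists x, y.
by rewrite -(finj _ _ (adj_vset xy) xG fx) -(finj _ _ (adjr _ _ xy) yG fy).
Qed.

Theorem corollary1p10 (R : realType) (T : finType) (G : sgraph T) (r : nat) :
  exists c : R, 0 < c /\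
    forall X Y : {set T},
      bipartite_parts G X Y ->
      r = (\max_(v in X) deg G v)%N ->
      forall (p k : nat) (F : finFieldType) (d : nat) (E : {set 'rV[F]_d}),
        prime p -> odd p -> (0 < k)%N -> #|F| = (p ^ k)%N -> (1 <= d)%N ->
        c * (#|F|%:R `^ Num.max ((d%:R + 1) / 2) r%:R) <= #|E|%:R ->
        ([set: F] `\ 0 `<=` graph_dist_set G E)%classic.
Proof.
(* Dependent random choice needs tuples of positive length, hence [maxn r 1], and the embedding
   needs more than [|T|] common neighbours. In [C], the [4] has square [16] for [distance_pairs_ge],
   and the rest serves dependent random choice. *)
pose s := maxn r 1; pose h := #|T|.+1; pose C := (4 + 2 ^ s * (h ^ s + h))%N.
exists C%:R; split; first by rewrite ltr0n.
move=> X Y GXY rE p k F d E p_pr p_odd k0 cF d1 hE t [_ t0].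
have {}t0 : t != 0 by apply/eqP.
have oF : odd #|F| by rewrite cF oddX p_odd orbT.
set q := #|F| in cF oF hE *; set n := #|E| in hE.
have q0 : (0 < q)%N by apply: odd_gt0.
have q1 : 1 <= q%:R :> R by rewrite ler1n.
set M := Num.max _ _ in hE.
(* For [r = 0] one has [s = 1], which is at most [(d+1)/2] because [d >= 1]. *)
have sM : s%:R <= M.
  rewrite /s /maxn /M; case: ifP => _; rewrite le_max; last by rewrite lexx orbT.
  by apply/orP; left; rewrite ler_pdivlMr // mul1r (natrD _ 1 1) lerD2r ler1n.
have hs : (C * q ^ s <= n)%N.
  rewrite -(ler_nat R) natrM natrX; apply: le_trans hE.
  by rewrite ler_wpM2l // -powR_mulrn // ler_powR.
have hd : (16 * q ^ d.+1 <= n ^ 2)%N.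
  rewrite -(ler_nat R) [leRHS]natrX; apply: le_trans (lerXn2r 2 _ _ hE).
  - rewrite exprMn natrM ler_pM //.
      by rewrite -natrX ler_nat (leq_exp2r 4 _ (isT : (0 < 2)%N)) leq_addr.
    have -> : (q ^ d.+1)%:R = (q%:R `^ ((d%:R + 1) / 2)) ^+ 2 :> R.
      rewrite -powR_mulrn ?powR_ge0 // -powRrM divfK ?pnatr_eq0 //.
      by rewrite (_ : d%:R + 1 = d.+1%:R) ?powR_mulrn ?natrX // -addn1 natrD.
    by rewrite lerXn2r ?nnegrE ?powR_ge0 // ler_powR // le_max lexx.
  - by rewrite nnegrE mulr_ge0 ?powR_ge0.
  by rewrite nnegrE.
have [psi psiP] := add_char_exists F.
pose e (x y : 'rV[F]_d) := qnorm (x - y) == t.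
have e_sym : symmetric e.
  move=> x y; rewrite /e; congr (_ == t).
  by apply: eq_bigr => i _; rewrite -opprB mxE sqrrN.
have s0 : (0 < s)%N by rewrite leq_maxr.
have hn : ((2 * q) ^ s * (h ^ s + h) <= n)%N.
  apply: leq_trans hs; rewrite expnMn mulnAC leq_mul2r /C leq_addl orbT //.
have [A [AE cA good]] := dependent_random_choice e_sym s0 q0 (ltn0Sn _)
  (distance_pairs_ge oF psiP t0 hd) hn.
have dX : {in X, forall v, deg G v <= s}%N.
  by move=> v vX; rewrite leq_max rE (leq_bigmax_cond _ vX).
have [f [finj fE fe]] := bipartite_embedding GXY dX e_sym AE cA good.
by apply: (embedding_graph_dist_set finj fE) => x y /fe /eqP.
Qed.
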